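(* For any set $X$, the oplax bimonoid structure $(X^2,\mu,\eta,\zeta,\nu)$ in the symmetric monoidal bicategory $\mathsf{Span}$, given by the groupoid pseudomonoid structure $(\mu,\eta)$ and the trivial comonoid structure $(\zeta,\nu)$, uniquely extends to an oplax Hopf monoid structure on $X^2$.
   Context: Coherence isomorphisms of monoidal bicategories are suppressed; $\sigma$ is the braiding. **The bicategory $\mathsf{Span}$.** Objects: sets; 1-cells: spans $X\xleftarrow{f}S\xrightarrow{g}Y$, written $(f,g)$; 2-cells $(f,g)\Rightarrow(h,k)$: functions $u\colon S\to T$ with $hu=f$, $ku=g$; composition by pullback; symmetric monoidal under $\times$ with unit the one-point set $1$ and braiding the span $(\mathrm{id},\mathrm{sw})$, $\mathrm{sw}(x,y)=(y,x)$. **Structures on $X^2$.** Write $\Delta$ for diagonals, $!$ for the map to $1$, $\pi_{13}(x,y,z)=(x,z)$. Groupoid pseudomonoid: $\mu=(1\times\Delta\times1,\pi_{13})\colon X^4\leftarrow X^3\to X^2$, $\eta=(!,\Delta)\colon1\leftarrow X\to X^2$, with the evident unique invertible associativity and unit constraints. Trivial comonoid: $\zeta=(\mathrm{id},\Delta_{X^2})\colon X^2\leftarrow X^2\to X^4$, $\nu=(\mathrm{id},!)\colon X^2\leftarrow X^2\to1$. **Oplax bimonoid.** A pseudocomonoid in the monoidal bicategory of pseudomonoids, oplax morphisms and their 2-cells: an object $M$ with a pseudomonoid structure $(m,j)$, a pseudocomonoid structure $(\delta,\varepsilon)$ and 2-cells $\theta\colon\delta m\Rightarrow(m\otimes m)(1\otimes\sigma\otimes1)(\delta\otimes\delta)$,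 $\theta_0\colon\delta j\Rightarrow j\otimes j$, $\chi\colon\varepsilon m\Rightarrow\varepsilon\otimes\varepsilon$, $\chi_0\colon\varepsilon j\Rightarrow1_I$ making $\delta,\varepsilon$ oplax pseudomonoid morphisms and such that the coassociativity and counit constraints are 2-cells of oplax pseudomonoid morphisms. For $(X^2,\mu,\eta,\zeta,\nu)$ these 2-cells are uniquely determined: $\theta$ is the unique span isomorphism available, $\theta_0=\Delta\colon X\to X^2$, $\chi=1\times\Delta\times1\colon X^3\to X^4$, $\chi_0=\,!\colon X\to1$. **Oplax Hopf monoid.** For an oplax bimonoid $M$ in $\mathcal K$, $\mathcal K(M,M)$ is a monoidal category under convolution $f\odot g=m(f\otimes g)\delta$ with unit $I^\odot=j\varepsilon$. An oplax inverse of an object $P$ of a monoidal category is an object $Q$ with morphisms $\tau_1\colon P\otimes Q\to I$, $\tau_2\colon Q\otimes P\to I$ such that $1_Q\otimes\tau_1=\tau_2\otimes1_Q$ and $\tau_1\otimes1_P=1_P\otimes\tau_2$, and these morphisms are invertible. An oplax antipode on $M$ is an oplax inverse of $1_M$ in $(\mathcal K(M,M),\odot,I^\odot)$, and an oplax Hopf monoid is an oplax bimonoid equipped with an oplax antipode. Uniqueness of an antipode is understood up to isomorphism $s\cong s'$ compatible with $\tau_1,\tau_2$. *)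

(* Defs.v *)
From mathcomp Require Import ssreflect ssrfun ssrbool.
From Stdlib Require Import FunctionalExtensionality ProofIrrelevance ClassicalEpsilon.

Set Implicit Arguments.
Unset Strict Implicit.
Unset Printing Implicit Defensive.

Record span (A B : Type) := Span {
  apex : Type;
  lft : apex -> A;
  rgt : apex -> B }.

Arguments lft {A B s} _.
Arguments rgt {A B s} _.

Record pullback (S T B : Type) (p : S -> B) (q : T -> B) := Pb {
  pb1 : S;
  pb2 : T;
  pb_eq : p pb1 = q pb2 }.

Definition comp A B C (g : span B C) (f : span A B) : span A C :=
  @Span A C (pullback (@rgt A B f) (@lft B C g))
    (fun e => lft (pb1 e)) (fun e => rgt (pb2 e)).

Definition graph A B (f : A -> B) : span A B := @Span A B A id f.

Definition one A : span A A := graph (@id A).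

Definition fprod A A' B B' (f : A -> A') (g : B -> B') (p : A * B) : A' * B' :=
  (f p.1, g p.2).

Definition tensor A A' B B' (f : span A A') (g : span B B') :
    span (A * B) (A' * B') :=
  @Span (A * B) (A' * B') (apex f * apex g) (fprod lft lft) (fprod rgt rgt).

Declare Scope span_scope.
Open Scope span_scope.
Notation "g ∘ f" := (comp g f) (at level 40, left associativity) : span_scope.
Notation "f ⊗ g" := (tensor f g) (at level 38, left associativity) : span_scope.
Notation "f × g" := (fprod f g) (at level 38, left associativity) : span_scope.

(** Coherence 1-cells of the monoidal structure are the spans [graph phi] for
    the canonical bijections [phi] of sets below. *)
Definition assoc A B C (p : A * B * C) : A * (B * C) := (p.1.1, (p.1.2, p.2)).
Definition assocV A B C (p : A * (B * C)) : A * B * C := ((p.1, p.2.1), p.2.2).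
Definition dup (u : unit) : unit * unit := (u, u).
(* [graph (@mid A B C D)] is the 1-cell written 1 ⊗ σ ⊗ 1, where σ is the
   braiding of B and C, that is the span (id, sw) with sw (b, c) = (c, b). *)
Definition mid A B C D (p : (A * B) * (C * D)) : (A * C) * (B * D) :=
  ((p.1.1, p.2.1), (p.1.2, p.2.2)).

(** A 2-cell [graph psi ∘ S ⇒ T ∘ graph phi] of Span is the same thing as a map
    of apices lying over [phi] and [psi].  Squares record the latter; they allow
    coherence 1-cells to be suppressed, and the 2-cells of Span are the squares
    over identities. *)

Record square A A' B B' (S : span A B) (T : span A' B')
    (phi : A -> A') (psi : B -> B') := Square {
  sqfun :> apex S -> apex T;
  sq_lft : forall s, lft (sqfun s) = phi (lft s);
  sq_rgt : forall s, rgt (sqfun s) = psi (rgt s) }.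

Notation cell S T := (square S T id id).

(* Boundaries of squares need only agree pointwise: [hcomp] and [recast] take
   proofs of this, which the notations below supply with this tactic. *)
Ltac boundary :=
  let x := fresh "x" in intro x;
  repeat match goal with
  | x : (_ * _)%type |- _ => destruct x
  | x : unit |- _ => destruct x
  end; reflexivity.

Definition recast A A' B B' (S : span A B) (T : span A' B') phi phi' psi psi'
    (P : square S T phi psi) (e : phi =1 phi') (e' : psi =1 psi') :
  square S T phi' psi'.
Proof.
by exists (sqfun P) => s; [rewrite sq_lft e | rewrite sq_rgt e'].
Defined.

Arguments recast {A A' B B' S T phi phi' psi psi'} & P e e'.

Definition vcomp A A' A'' B B' B'' (S : span A B) (T : span A' B')
    (U : span A'' B'') phi psi phi' psi'
    (P : square S T phi psi) (Q : square T U phi' psi') :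
  square S U (phi' \o phi) (psi' \o psi).
Proof.
by exists (fun s => Q (P s)) => s /=; rewrite ?sq_lft ?sq_rgt.
Defined.

Definition hcomp A A' B B' C C' (S : span A B) (T : span A' B')
    (S' : span B C) (T' : span B' C') phi psi psi' chi
    (Q : square S' T' psi' chi) (P : square S T phi psi) (e : psi =1 psi') :
  square (S' ∘ S) (T' ∘ T) phi chi.
Proof.
unshelve eexists.
- move=> x; exists (P (pb1 x)) (Q (pb2 x)).
  abstract by rewrite sq_rgt sq_lft e (pb_eq x).
- by move=> x /=; rewrite sq_lft.
- by move=> x /=; rewrite sq_rgt.
Defined.

Definition tens A A' B B' C C' D D' (S : span A B) (T : span A' B')
    (S' : span C D) (T' : span C' D') phi psi phi' psi'
    (P : square S T phi psi) (P' : square S' T' phi' psi') :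
  square (S ⊗ S') (T ⊗ T') (phi × phi') (psi × psi').
Proof.
unshelve eexists (fprod P P').
- by case=> s s'; rewrite /= /fprod /= !sq_lft.
- by case=> s s'; rewrite /= /fprod /= !sq_rgt.
Defined.

Definition idq A B (S : span A B) : cell S S.
Proof. by exists id. Defined.

Notation "P ;; Q" := (vcomp P Q) (at level 50, left associativity) : span_scope.
Notation "Q ⊚ P" := (hcomp Q P ltac:(boundary))
  (at level 40, left associativity, only parsing) : span_scope.
Notation "P ⊠ Q" := (tens P Q) (at level 38, left associativity) : span_scope.
Notation "⟪ P ⟫" := (recast P ltac:(boundary) ltac:(boundary))
  (at level 0, P at level 60, only parsing) : span_scope.

Section Coherence.
Variables (A B C D A' B' C' D' : Type).

Definition comp_assoc (h : span C D) (g : span B C) (f : span A B) :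
  cell (h ∘ g ∘ f) (h ∘ (g ∘ f)).
Proof.
unshelve eexists.
- move=> x; exists (@Pb _ _ _ rgt lft (pb1 x) (pb1 (pb2 x)) (pb_eq x))
    (pb2 (pb2 x)).
  exact: (pb_eq (pb2 x)).
- by [].
- by [].
Defined.

Definition comp_assocV (h : span C D) (g : span B C) (f : span A B) :
  cell (h ∘ (g ∘ f)) (h ∘ g ∘ f).
Proof.
unshelve eexists.
- move=> x; exists (pb1 (pb1 x)) (@Pb _ _ _ rgt lft (pb2 (pb1 x)) (pb2 x) (pb_eq x)).
  exact: (pb_eq (pb1 x)).
- by [].
- by [].
Defined.

Definition comp_1l (f : span A B) : cell (one B ∘ f) f.
Proof. by exists (fun x => pb1 x) => // x; exact: pb_eq. Defined.

Definition comp_1lV (f : span A B) : cell f (one B ∘ f).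
Proof. by unshelve eexists (fun x => @Pb _ _ _ rgt _ x (rgt x) _). Defined.

Definition comp_1r (f : span A B) : cell (f ∘ one A) f.
Proof. by exists (fun x => pb2 x) => // x; symmetry; exact: pb_eq. Defined.

Definition comp_1rV (f : span A B) : cell f (f ∘ one A).
Proof. by unshelve eexists (fun x => @Pb _ _ _ _ lft (lft x) x _). Defined.

Definition interchange (g : span B C) (f : span A B) (g' : span B' C')
    (f' : span A' B') : cell ((g ⊗ g') ∘ (f ⊗ f')) ((g ∘ f) ⊗ (g' ∘ f')).
Proof.
unshelve eexists.
- move=> x; split.
  + exists (pb1 x).1 (pb2 x).1; exact: (f_equal fst (pb_eq x)).
  + exists (pb1 x).2 (pb2 x).2; exact: (f_equal snd (pb_eq x)).
- by [].
- by [].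
Defined.

Definition interchangeV (g : span B C) (f : span A B) (g' : span B' C')
    (f' : span A' B') : cell ((g ∘ f) ⊗ (g' ∘ f')) ((g ⊗ g') ∘ (f ⊗ f')).
Proof.
unshelve eexists.
- move=> x; exists (pb1 x.1, pb1 x.2) (pb2 x.1, pb2 x.2).
  abstract by rewrite /= /fprod /= !pb_eq.
- by [].
- by [].
Defined.

Definition tens_1 : cell (one A ⊗ one B) (one (A * B)).
Proof. by exists (fun x : A * B => x) => -[]. Defined.

Definition tens_1V : cell (one (A * B)) (one A ⊗ one B).
Proof. by exists (fun x : A * B => x) => -[]. Defined.

Definition tassoc (f : span A A') (g : span B B') (h : span C C') :
  square (f ⊗ g ⊗ h) (f ⊗ (g ⊗ h)) (@assoc A B C) (@assoc A' B' C').
Proof. by exists (@assoc _ _ _). Defined.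

Definition tassocV (f : span A A') (g : span B B') (h : span C C') :
  square (f ⊗ (g ⊗ h)) (f ⊗ g ⊗ h) (@assocV A B C) (@assocV A' B' C').
Proof. by exists (@assocV _ _ _). Defined.

Definition tmid (f : span A A') (g : span B B') (h : span C C')
    (k : span D D') :
  square ((f ⊗ g) ⊗ (h ⊗ k)) ((f ⊗ h) ⊗ (g ⊗ k))
    (@mid A B C D) (@mid A' B' C' D').
Proof. by exists (@mid _ _ _ _). Defined.

Definition tsnd (f : span A A') (g : span B B') : square (f ⊗ g) g snd snd.
Proof. by exists snd. Defined.

Definition tfst (f : span A A') (g : span B B') : square (f ⊗ g) f fst fst.
Proof. by exists fst. Defined.

(* Composing with the 1-cell [graph phi] amounts to changing the boundary. *)

Definition absorb (T : span B C) (phi : A -> B) :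
  square (T ∘ graph phi) T phi id.
Proof. by exists (fun x => pb2 x) => // x; symmetry; exact: pb_eq. Defined.

Definition unabsorb (T : span B C) (phi : A -> B) (phiV : B -> A)
    (K : cancel phiV phi) : square T (T ∘ graph phi) phiV id.
Proof.
unshelve eexists (fun t => @Pb _ _ _ (@rgt _ _ (graph phi)) lft (phiV (lft t)) t _) => //.
Defined.

Definition slide (S : span A B) (T : span A' B') (phi : A -> A') (psi : B -> B')
    (phiV : A' -> A) (psiV : B' -> B) (P : square T S phiV psiV)
    (K : cancel phi phiV) (K' : cancel psiV psi) :
  cell (T ∘ graph phi) (graph psi ∘ S).
Proof.
unshelve eexists.
- move=> x; exists (P (pb2 x)) (psiV (rgt (pb2 x))).
  exact: sq_rgt.
- by move=> x /=; rewrite sq_lft -(pb_eq x) /=; exact: K.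
- by move=> x /=; exact: K'.
Defined.

End Coherence.

Lemma assocK A B C : cancel (@assoc A B C) (@assocV A B C).
Proof. by case=> -[]. Qed.

Lemma assocVK A B C : cancel (@assocV A B C) (@assoc A B C).
Proof. by case=> ? []. Qed.

Lemma dupK : cancel (fun=> tt) dup.
Proof. by case=> -[] []. Qed.

Lemma midK A B C D : cancel (@mid A B C D) (@mid A C B D).
Proof. by case=> -[? ?] []. Qed.

Record psmon_data (M : Type) := PsmonData {
  pm_m : span (M * M) M;
  pm_j : span unit M;
  pm_a : square (pm_m ∘ (pm_m ⊗ one M)) (pm_m ∘ (one M ⊗ pm_m))
           (@assoc M M M) id;
  pm_l : square (pm_m ∘ (pm_j ⊗ one M)) (one M) snd id;
  pm_r : square (pm_m ∘ (one M ⊗ pm_j)) (one M) fst id }.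

Section Star.
Variables (M : Type) (p : psmon_data M).
Local Notation m := (pm_m p).
Local Notation j := (pm_j p).

(** For 1-cells [f : A → M] and [g : B → M], [star f g] is [m (f ⊗ g)]; the
    constraints extend to [star] by whiskering and coherence. *)
Definition star A B (f : span A M) (g : span B M) : span (A * B) M :=
  m ∘ (f ⊗ g).

Definition star2 A A' B B' (f : span A M) (f' : span A' M) (g : span B M)
    (g' : span B' M) phi psi (P : square f f' phi id) (Q : square g g' psi id) :
  square (star f g) (star f' g') (phi × psi) id :=
  idq m ⊚ (P ⊠ Q).

Definition star_a A B C (f : span A M) (g : span B M) (h : span C M) :
  square (star (star f g) h) (star f (star g h)) (@assoc A B C) id :=
  ⟪ idq m ⊚ (idq (star f g) ⊠ comp_1lV h)
    ;; idq m ⊚ interchangeV m (f ⊗ g) (one M) h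
    ;; comp_assocV m (m ⊗ one M) (f ⊗ g ⊗ h)
    ;; pm_a p ⊚ tassoc f g h
    ;; comp_assoc m (one M ⊗ m) (f ⊗ (g ⊗ h))
    ;; idq m ⊚ interchange (one M) f m (g ⊗ h)
    ;; idq m ⊚ (comp_1l f ⊠ idq (star g h)) ⟫.

Definition star_l B (g : span B M) : square (star j g) g snd id :=
  ⟪ idq m ⊚ (comp_1rV j ⊠ comp_1lV g)
    ;; idq m ⊚ interchangeV j (one unit) (one M) g
    ;; comp_assocV m (j ⊗ one M) (one unit ⊗ g)
    ;; pm_l p ⊚ tsnd (one unit) g
    ;; comp_1l g ⟫.

Definition star_r A (f : span A M) : square (star f j) f fst id :=
  ⟪ idq m ⊚ (comp_1lV f ⊠ comp_1rV j)
    ;; idq m ⊚ interchangeV (one M) f j (one unit)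
    ;; comp_assocV m (one M ⊗ j) (f ⊗ one unit)
    ;; pm_r p ⊚ tfst f (one unit)
    ;; comp_1l f ⟫.

(* A 2-cell is determined by its map of apices, so equations between pasted
   2-cells are stated as pointwise equalities of functions.  Up to unit coherence
   [star i i] is m, [star (star i i) i] is m (m ⊗ 1), and so on. *)
Record is_psmon : Prop := IsPsmon {
  pm_a_iso : bijective (pm_a p);
  pm_l_iso : bijective (pm_l p);
  pm_r_iso : bijective (pm_r p);
  pm_pentagon :
    let i := one M in
    star_a (star i i) i i ;; star_a i i (star i i)
    =1 star2 (star_a i i i) (idq i) ;; star_a i (star i i) i
       ;; star2 (idq i) (star_a i i i);
  pm_triangle :
    let i := one M in
    star_a i j i ;; star2 (idq i) (star_l i) =1 star2 (star_r i) (idq i) }.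

End Star.

Definition unit_psmon : psmon_data unit.
Proof.
refine (@PsmonData _ (graph (fun=> tt)) (one unit) _ _ _).
- unshelve eexists.
  + by move=> x; exists (tt, (tt, tt)) (tt, tt).
  + by move=> x; case: (lft x) => -[[] []] [].
  + by move=> x; case: (rgt x).
- unshelve eexists.
  + exact: (fun=> tt).
  + by move=> x; case: (lft x) => ? [].
  + by move=> x; case: (rgt x).
- unshelve eexists.
  + exact: (fun=> tt).
  + by move=> x; case: (lft x) => -[] ?.
  + by move=> x; case: (rgt x).
Defined.

Section TensorPsmon.
Variables (M N : Type) (p : psmon_data M) (q : psmon_data N).
Local Notation i := (one _).

Definition tensor_m : span ((M * N) * (M * N)) (M * N) :=
  (pm_m p ⊗ pm_m q) ∘ graph (@mid M N M N).

Definition tensor_j : span unit (M * N) := (pm_j p ⊗ pm_j q) ∘ graph dup.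

Definition tensor_a :
  square (tensor_m ∘ (tensor_m ⊗ one (M * N)))
    (tensor_m ∘ (one (M * N) ⊗ tensor_m)) (@assoc _ _ _) id :=
  ⟪ absorb (pm_m p ⊗ pm_m q) (@mid M N M N)
      ⊚ (absorb (pm_m p ⊗ pm_m q) (@mid M N M N) ⊠ tens_1V M N
         ;; tmid (pm_m p) (pm_m q) i i)
    ;; interchange (pm_m p) (pm_m p ⊗ i) (pm_m q) (pm_m q ⊗ i)
    ;; pm_a p ⊠ pm_a q
    ;; interchangeV (pm_m p) (i ⊗ pm_m p) (pm_m q) (i ⊗ pm_m q)
    ;; unabsorb (pm_m p ⊗ pm_m q) (@midK M M N N)
         ⊚ (tmid i (pm_m p) i (pm_m q)
            ;; tens_1 M N ⊠ unabsorb (pm_m p ⊗ pm_m q) (@midK M M N N)) ⟫.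

Definition tensor_l :
  square (tensor_m ∘ (tensor_j ⊗ one (M * N))) (one (M * N)) snd id :=
  ⟪ absorb (pm_m p ⊗ pm_m q) (@mid M N M N)
      ⊚ (absorb (pm_j p ⊗ pm_j q) dup ⊠ tens_1V M N
         ;; tmid (pm_j p) (pm_j q) i i)
    ;; interchange (pm_m p) (pm_j p ⊗ i) (pm_m q) (pm_j q ⊗ i)
    ;; pm_l p ⊠ pm_l q
    ;; tens_1 M N ⟫.

Definition tensor_r :
  square (tensor_m ∘ (one (M * N) ⊗ tensor_j)) (one (M * N)) fst id :=
  ⟪ absorb (pm_m p ⊗ pm_m q) (@mid M N M N)
      ⊚ (tens_1V M N ⊠ absorb (pm_j p ⊗ pm_j q) dup
         ;; tmid i i (pm_j p) (pm_j q))
    ;; interchange (pm_m p) (i ⊗ pm_j p) (pm_m q) (i ⊗ pm_j q)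
    ;; pm_r p ⊠ pm_r q
    ;; tens_1 M N ⟫.

Definition tensor_psmon : psmon_data (M * N) :=
  PsmonData tensor_a tensor_l tensor_r.

End TensorPsmon.

Notation "p ⊗m q" := (tensor_psmon p q) (at level 38, left associativity)
  : span_scope.

Record oplax_data M N (p : psmon_data M) (q : psmon_data N) := OplaxData {
  om :> span M N;
  om_m : cell (om ∘ pm_m p) (pm_m q ∘ (om ⊗ om));
  om_j : cell (om ∘ pm_j p) (pm_j q) }.

Section Oplax.
Variables (M N : Type) (p : psmon_data M) (q : psmon_data N).
Variable f : oplax_data p q.

Definition om_star A B (x : span A M) (y : span B M) :
  cell (f ∘ star p x y) (star q (f ∘ x) (f ∘ y)) :=
  comp_assocV f (pm_m p) (x ⊗ y)
  ;; om_m f ⊚ idq (x ⊗ y)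
  ;; comp_assoc (pm_m q) (f ⊗ f) (x ⊗ y)
  ;; idq (pm_m q) ⊚ interchange f x f y.

Record is_oplax : Prop := IsOplax {
  om_assoc :
    let i := one M in
    om_star (star p i i) i ;; star2 q (om_star i i) (idq (f ∘ i))
      ;; star_a q (f ∘ i) (f ∘ i) (f ∘ i)
    =1 idq f ⊚ star_a p i i i ;; om_star i (star p i i)
      ;; star2 q (idq (f ∘ i)) (om_star i i);
  om_unitl :
    let i := one M in
    om_star (pm_j p) i ;; star2 q (om_j f) (idq (f ∘ i)) ;; star_l q (f ∘ i)
    =1 idq f ⊚ star_l p i;
  om_unitr :
    let i := one M in
    om_star i (pm_j p) ;; star2 q (idq (f ∘ i)) (om_j f) ;; star_r q (f ∘ i)
    =1 idq f ⊚ star_r p i }.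

End Oplax.

Definition oplax_id M (p : psmon_data M) : oplax_data p p :=
  @OplaxData _ _ p p (one M)
    (⟪ comp_1l (pm_m p) ;; comp_1rV (pm_m p) ;; idq (pm_m p) ⊚ tens_1V M M ⟫)
    (comp_1l (pm_j p)).

Definition oplax_comp M N L (p : psmon_data M) (q : psmon_data N)
    (r : psmon_data L) (g : oplax_data q r) (f : oplax_data p q) :
  oplax_data p r :=
  @OplaxData _ _ p r (g ∘ f)
    (⟪ comp_assoc g f (pm_m p)
       ;; idq g ⊚ om_m f
       ;; comp_assocV g (pm_m q) (f ⊗ f)
       ;; om_m g ⊚ idq (f ⊗ f)
       ;; comp_assoc (pm_m r) (g ⊗ g) (f ⊗ f)
       ;; idq (pm_m r) ⊚ interchange g f g f ⟫)
    (⟪ comp_assoc g f (pm_j p) ;; idq g ⊚ om_j f ;; om_j g ⟫).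

Definition oplax_tensor M N M' N' (p : psmon_data M) (q : psmon_data N)
    (p' : psmon_data M') (q' : psmon_data N')
    (f : oplax_data p q) (f' : oplax_data p' q') :
  oplax_data (p ⊗m p') (q ⊗m q') :=
  @OplaxData _ _ (p ⊗m p') (q ⊗m q') (f ⊗ f')
    (⟪ comp_assocV (f ⊗ f') (pm_m p ⊗ pm_m p') (graph (@mid M M' M M'))
       ;; interchange f (pm_m p) f' (pm_m p') ⊚ idq (graph (@mid M M' M M'))
       ;; (om_m f ⊠ om_m f') ⊚ idq (graph (@mid M M' M M'))
       ;; interchangeV (pm_m q) (f ⊗ f) (pm_m q') (f' ⊗ f') ⊚ idq (graph (@mid M M' M M'))
       ;; comp_assoc (pm_m q ⊗ pm_m q') ((f ⊗ f) ⊗ (f' ⊗ f')) (graph (@mid M M' M M'))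
       ;; idq (pm_m q ⊗ pm_m q')
          ⊚ slide (tmid f f f' f') (@midK M M' M M') (@midK N N N' N')
       ;; comp_assocV (pm_m q ⊗ pm_m q') (graph (@mid N N' N N'))
             ((f ⊗ f') ⊗ (f ⊗ f')) ⟫)
    (⟪ comp_assocV (f ⊗ f') (pm_j p ⊗ pm_j p') (graph dup)
       ;; interchange f (pm_j p) f' (pm_j p') ⊚ idq (graph dup)
       ;; (om_j f ⊠ om_j f') ⊚ idq (graph dup) ⟫).

(** The coherence bijections are (strong) morphisms of pseudomonoids. *)
Record coh_psmon M N (p : psmon_data M) (q : psmon_data N) (psi : M -> N) :=
  CohPsmon {
    coh_m : square (pm_m p) (pm_m q) (psi × psi) psi;
    coh_j : square (pm_j p) (pm_j q) id psi }.

Section Coh.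
Variables (M N L : Type).
Variables (p : psmon_data M) (q : psmon_data N) (r : psmon_data L).

Definition coh_assoc_m :
  square (pm_m (p ⊗m q ⊗m r)) (pm_m (p ⊗m (q ⊗m r)))
    (@assoc M N L × @assoc M N L) (@assoc M N L) :=
  ⟪ absorb (tensor_m p q ⊗ pm_m r) (@mid _ _ _ _)
    ;; absorb (pm_m p ⊗ pm_m q) (@mid _ _ _ _) ⊠ idq (pm_m r)
    ;; tassoc (pm_m p) (pm_m q) (pm_m r)
    ;; idq (pm_m p) ⊠ unabsorb (pm_m q ⊗ pm_m r) (@midK _ _ _ _)
    ;; unabsorb (pm_m p ⊗ tensor_m q r) (@midK _ _ _ _) ⟫.

Definition coh_assoc_j :
  square (pm_j (p ⊗m q ⊗m r)) (pm_j (p ⊗m (q ⊗m r))) id (@assoc M N L) :=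
  ⟪ absorb (tensor_j p q ⊗ pm_j r) dup
    ;; absorb (pm_j p ⊗ pm_j q) dup ⊠ idq (pm_j r)
    ;; tassoc (pm_j p) (pm_j q) (pm_j r)
    ;; idq (pm_j p) ⊠ unabsorb (pm_j q ⊗ pm_j r) dupK
    ;; unabsorb (pm_j p ⊗ tensor_j q r) dupK ⟫.

Definition coh_assoc : coh_psmon (p ⊗m q ⊗m r) (p ⊗m (q ⊗m r)) (@assoc M N L) :=
  CohPsmon coh_assoc_m coh_assoc_j.

Definition coh_snd_m : square (pm_m (unit_psmon ⊗m p)) (pm_m p) (snd × snd) snd :=
  ⟪ absorb (pm_m unit_psmon ⊗ pm_m p) (@mid _ _ _ _)
    ;; tsnd (pm_m unit_psmon) (pm_m p) ⟫.

Definition coh_snd_j : square (pm_j (unit_psmon ⊗m p)) (pm_j p) id snd :=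
  ⟪ absorb (pm_j unit_psmon ⊗ pm_j p) dup
    ;; tsnd (pm_j unit_psmon) (pm_j p) ⟫.

Definition coh_snd : coh_psmon (unit_psmon ⊗m p) p snd :=
  CohPsmon coh_snd_m coh_snd_j.

Definition coh_fst_m : square (pm_m (p ⊗m unit_psmon)) (pm_m p) (fst × fst) fst :=
  ⟪ absorb (pm_m p ⊗ pm_m unit_psmon) (@mid _ _ _ _)
    ;; tfst (pm_m p) (pm_m unit_psmon) ⟫.

Definition coh_fst_j : square (pm_j (p ⊗m unit_psmon)) (pm_j p) id fst :=
  ⟪ absorb (pm_j p ⊗ pm_j unit_psmon) dup
    ;; tfst (pm_j p) (pm_j unit_psmon) ⟫.

Definition coh_fst : coh_psmon (p ⊗m unit_psmon) p fst :=
  CohPsmon coh_fst_m coh_fst_j.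

End Coh.

(** A 2-cell of oplax morphisms from [f : p → q] to [g : p → q'], the codomains
    being compared along a coherence bijection. *)
Record is_oplax_2cell M N N' (p : psmon_data M) (q : psmon_data N)
    (q' : psmon_data N') (f : oplax_data p q) (g : oplax_data p q')
    (psi : N -> N') (c : coh_psmon q q' psi) (u : square f g id psi) : Prop :=
  IsOplax2cell {
    o2_m : om_m f ;; coh_m c ⊚ (u ⊠ u) =1 u ⊚ idq (pm_m p) ;; om_m g;
    o2_j : om_j f ;; coh_j c =1 u ⊚ idq (pm_j p) ;; om_j g }.

Record pscom_data (M : Type) := PscomData {
  pc_d : span M (M * M);
  pc_e : span M unit;
  pc_a : square ((pc_d ⊗ one M) ∘ pc_d) ((one M ⊗ pc_d) ∘ pc_d)
           id (@assoc M M M);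
  pc_l : square ((pc_e ⊗ one M) ∘ pc_d) (one M) id snd;
  pc_r : square ((one M ⊗ pc_e) ∘ pc_d) (one M) id fst }.

Section Costar.
Variables (M : Type) (c : pscom_data M).
Local Notation d := (pc_d c).
Local Notation e := (pc_e c).

Definition costar A B (f : span M A) (g : span M B) : span M (A * B) :=
  (f ⊗ g) ∘ d.

Definition costar2 A A' B B' (f : span M A) (f' : span M A') (g : span M B)
    (g' : span M B') phi psi (P : square f f' id phi) (Q : square g g' id psi) :
  square (costar f g) (costar f' g') id (phi × psi) :=
  (P ⊠ Q) ⊚ idq d.

Definition costar_a A B C (f : span M A) (g : span M B) (h : span M C) :
  square (costar (costar f g) h) (costar f (costar g h)) id (@assoc A B C) :=
  ⟪ (idq (costar f g) ⊠ comp_1rV h) ⊚ idq d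
    ;; interchangeV (f ⊗ g) d h (one M) ⊚ idq d
    ;; comp_assoc (f ⊗ g ⊗ h) (d ⊗ one M) d
    ;; tassoc f g h ⊚ pc_a c
    ;; comp_assocV (f ⊗ (g ⊗ h)) (one M ⊗ d) d
    ;; interchange f (one M) (g ⊗ h) d ⊚ idq d
    ;; (comp_1r f ⊠ idq (costar g h)) ⊚ idq d ⟫.

Definition costar_l B (g : span M B) : square (costar e g) g id snd :=
  ⟪ (comp_1lV e ⊠ comp_1rV g) ⊚ idq d
    ;; interchangeV (one unit) e g (one M) ⊚ idq d
    ;; comp_assoc (one unit ⊗ g) (e ⊗ one M) d
    ;; tsnd (one unit) g ⊚ pc_l c
    ;; comp_1r g ⟫.

Definition costar_r A (f : span M A) : square (costar f e) f id fst :=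
  ⟪ (comp_1rV f ⊠ comp_1lV e) ⊚ idq d
    ;; interchangeV f (one M) (one unit) e ⊚ idq d
    ;; comp_assoc (f ⊗ one unit) (one M ⊗ e) d
    ;; tfst f (one unit) ⊚ pc_r c
    ;; comp_1r f ⟫.

Record is_pscom : Prop := IsPscom {
  pc_a_iso : bijective (pc_a c);
  pc_l_iso : bijective (pc_l c);
  pc_r_iso : bijective (pc_r c);
  pc_pentagon :
    let i := one M in
    costar_a (costar i i) i i ;; costar_a i i (costar i i)
    =1 costar2 (costar_a i i i) (idq i) ;; costar_a i (costar i i) i
       ;; costar2 (idq i) (costar_a i i i);
  pc_triangle :
    let i := one M in
    costar_a i e i ;; costar2 (idq i) (costar_l i)
    =1 costar2 (costar_r i) (idq i) }.

End Costar.

Record oplax_bimonoid (M : Type) := OplaxBimonoid {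
  ob_mon : psmon_data M;
  ob_com : pscom_data M;
  ob_theta : cell (pc_d ob_com ∘ pm_m ob_mon)
               (pm_m (ob_mon ⊗m ob_mon) ∘ (pc_d ob_com ⊗ pc_d ob_com));
  ob_theta0 : cell (pc_d ob_com ∘ pm_j ob_mon) (pm_j (ob_mon ⊗m ob_mon));
  ob_chi : cell (pc_e ob_com ∘ pm_m ob_mon)
             (pm_m unit_psmon ∘ (pc_e ob_com ⊗ pc_e ob_com));
  ob_chi0 : cell (pc_e ob_com ∘ pm_j ob_mon) (one unit);
  ob_d := OplaxData ob_theta ob_theta0;
  ob_e := @OplaxData _ _ ob_mon unit_psmon (pc_e ob_com) ob_chi ob_chi0;
  ob_monP : is_psmon ob_mon;
  ob_comP : is_pscom ob_com;
  ob_dP : is_oplax ob_d;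
  ob_eP : is_oplax ob_e;
  ob_aP : is_oplax_2cell
            (f := oplax_comp (oplax_tensor ob_d (oplax_id ob_mon)) ob_d)
            (g := oplax_comp (oplax_tensor (oplax_id ob_mon) ob_d) ob_d)
            (coh_assoc ob_mon ob_mon ob_mon) (pc_a ob_com);
  ob_lP : is_oplax_2cell
            (f := oplax_comp (oplax_tensor ob_e (oplax_id ob_mon)) ob_d)
            (g := oplax_id ob_mon) (coh_snd ob_mon) (pc_l ob_com);
  ob_rP : is_oplax_2cell
            (f := oplax_comp (oplax_tensor (oplax_id ob_mon) ob_e) ob_d)
            (g := oplax_id ob_mon) (coh_fst ob_mon) (pc_r ob_com) }.

Definition is_iso (ob : Type) (hom : ob -> ob -> Type) (idm : forall a, hom a a)
    (cmp : forall a b c, hom b c -> hom a b -> hom a c) a b (u : hom a b) : Prop :=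
  exists v : hom b a, cmp _ _ _ v u = idm a /\ cmp _ _ _ u v = idm b.

Record moncat := Moncat {
  ob : Type;
  hom : ob -> ob -> Type;
  idm : forall a, hom a a;
  cmp : forall a b c, hom b c -> hom a b -> hom a c;
  ten : ob -> ob -> ob;
  tenm : forall a a' b b', hom a a' -> hom b b' -> hom (ten a b) (ten a' b');
  tunit : ob;
  asc : forall a b c, hom (ten (ten a b) c) (ten a (ten b c));
  lun : forall a, hom (ten tunit a) a;
  run : forall a, hom (ten a tunit) a;
  cmpA : forall a b c d (w : hom c d) (v : hom b c) (u : hom a b),
    cmp w (cmp v u) = cmp (cmp w v) u;
  cmp1l : forall a b (u : hom a b), cmp (idm b) u = u;
  cmp1r : forall a b (u : hom a b), cmp u (idm a) = u;
  tenm_id : forall a b, tenm (idm a) (idm b) = idm (ten a b);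
  tenm_cmp : forall a b c a' b' c' (v : hom b c) (u : hom a b)
    (v' : hom b' c') (u' : hom a' b'),
    tenm (cmp v u) (cmp v' u') = cmp (tenm v v') (tenm u u');
  asc_iso : forall a b c, is_iso idm cmp (asc a b c);
  lun_iso : forall a, is_iso idm cmp (lun a);
  run_iso : forall a, is_iso idm cmp (run a);
  asc_nat : forall a b c a' b' c' (u : hom a a') (v : hom b b') (w : hom c c'),
    cmp (asc a' b' c') (tenm (tenm u v) w)
    = cmp (tenm u (tenm v w)) (asc a b c);
  lun_nat : forall a b (u : hom a b),
    cmp (lun b) (tenm (idm tunit) u) = cmp u (lun a);
  run_nat : forall a b (u : hom a b),
    cmp (run b) (tenm u (idm tunit)) = cmp u (run a);
  pentagon : forall a b c d,
    cmp (asc a b (ten c d)) (asc (ten a b) c d)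
    = cmp (tenm (idm a) (asc b c d))
        (cmp (asc a (ten b c) d) (tenm (asc a b c) (idm d)));
  triangle : forall a b,
    cmp (tenm (idm a) (lun b)) (asc a tunit b) = tenm (run a) (idm b) }.

Arguments idm {_} _.

Record oplax_inverse (V : moncat) (P : ob V) := OplaxInverse {
  oi_obj : ob V;
  oi_tau1 : hom (ten P oi_obj) (tunit V);
  oi_tau2 : hom (ten oi_obj P) (tunit V);
  oi_eq1 :
    cmp (run oi_obj) (cmp (tenm (idm oi_obj) oi_tau1) (asc oi_obj P oi_obj))
    = cmp (lun oi_obj) (tenm oi_tau2 (idm oi_obj));
  oi_eq2 :
    cmp (lun P) (tenm oi_tau1 (idm P))
    = cmp (run P) (cmp (tenm (idm P) oi_tau2) (asc P oi_obj P));
  oi_iso1l : is_iso (@idm V) (@cmp V) (tenm (idm oi_obj) oi_tau1);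
  oi_iso1r : is_iso (@idm V) (@cmp V) (tenm oi_tau2 (idm oi_obj));
  oi_iso2l : is_iso (@idm V) (@cmp V) (tenm oi_tau1 (idm P));
  oi_iso2r : is_iso (@idm V) (@cmp V) (tenm (idm P) oi_tau2) }.

Definition oplax_inverse_iso (V : moncat) (P : ob V) (Q Q' : oplax_inverse P) :
    Prop :=
  exists u : hom (oi_obj Q) (oi_obj Q'),
    [/\ is_iso (@idm V) (@cmp V) u,
        cmp (oi_tau1 Q') (tenm (idm P) u) = oi_tau1 Q
      & cmp (oi_tau2 Q') (tenm u (idm P)) = oi_tau2 Q].

Lemma pb_ext S T B (p : S -> B) (q : T -> B) (x y : pullback p q) :
  pb1 x = pb1 y -> pb2 x = pb2 y -> x = y.
Proof.
case: x y => a b e [a' b' e'] /= ea eb; move: e; rewrite ea eb => e.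
by rewrite (proof_irrelevance _ e e').
Qed.

Lemma pair_ext A B (p q : A * B) : p.1 = q.1 -> p.2 = q.2 -> p = q.
Proof. by case: p q => ? ? [? ?] /= -> ->. Qed.

Lemma cell_ext A B (S T : span A B) (P Q : cell S T) : P =1 Q -> P = Q.
Proof.
case: P Q => P p p' [Q q q'] /= /functional_extensionality e.
by move: p p'; rewrite e => p p'; congr Square; exact: proof_irrelevance.
Qed.

Section Convolution.
Variables (M : Type) (p : psmon_data M) (c : pscom_data M).
Hypotheses (Hp : is_psmon p) (Hc : is_pscom c).
Local Notation m := (pm_m p).
Local Notation j := (pm_j p).
Local Notation d := (pc_d c).
Local Notation e := (pc_e c).
Local Notation i := (one M).

Definition conv (f g : span M M) : span M M := m ∘ (f ⊗ g) ∘ d.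

Definition conv1 : span M M := j ∘ e.

Definition conv2 (f f' g g' : span M M) (u : cell f f') (v : cell g g') :
  cell (conv f g) (conv f' g') :=
  idq m ⊚ (u ⊠ v) ⊚ idq d.

Definition conv_id (f : span M M) : cell f f := idq f.

Definition conv_cmp (f g h : span M M) (v : cell g h) (u : cell f g) :
  cell f h := u ;; v.

Definition conv_a (f g h : span M M) :
  cell (conv (conv f g) h) (conv f (conv g h)) :=
  ⟪ idq m ⊚ (idq (conv f g) ⊠ comp_1rV h) ⊚ idq d
    ;; idq m ⊚ interchangeV (star p f g) d h i ⊚ idq d
    ;; comp_assocV m (star p f g ⊗ h) (d ⊗ i) ⊚ idq d
    ;; comp_assoc (star p (star p f g) h) (d ⊗ i) d
    ;; star_a p f g h ⊚ pc_a c
    ;; comp_assocV (star p f (star p g h)) (i ⊗ d) d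
    ;; comp_assoc m (f ⊗ star p g h) (i ⊗ d) ⊚ idq d
    ;; idq m ⊚ interchange f i (star p g h) d ⊚ idq d
    ;; idq m ⊚ (comp_1r f ⊠ idq (conv g h)) ⊚ idq d ⟫.

Definition conv_l (g : span M M) : cell (conv conv1 g) g :=
  ⟪ idq m ⊚ (idq conv1 ⊠ comp_1rV g) ⊚ idq d
    ;; idq m ⊚ interchangeV j e g i ⊚ idq d
    ;; comp_assocV m (j ⊗ g) (e ⊗ i) ⊚ idq d
    ;; comp_assoc (star p j g) (e ⊗ i) d
    ;; star_l p g ⊚ pc_l c
    ;; comp_1r g ⟫.

Definition conv_r (f : span M M) : cell (conv f conv1) f :=
  ⟪ idq m ⊚ (comp_1rV f ⊠ idq conv1) ⊚ idq d
    ;; idq m ⊚ interchangeV f i j e ⊚ idq d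
    ;; comp_assocV m (f ⊗ j) (i ⊗ e) ⊚ idq d
    ;; comp_assoc (star p f j) (i ⊗ e) d
    ;; star_r p f ⊚ pc_r c
    ;; comp_1r f ⟫.

(* The associativity constraints, acting on pairs of composable elements (the
   values at other pairs are irrelevant). *)
Lemma actA : exists F : apex m -> apex m -> apex m * apex m,
  forall x : apex (m ∘ (m ⊗ i)),
    (pb1 (pm_a p x)).2 = (F (pb1 x).1 (pb2 x)).1 /\
    pb2 (pm_a p x) = (F (pb1 x).1 (pb2 x)).2.
Proof.
have Hx (s t : apex m) : exists st : apex m * apex m,
  forall x : apex (m ∘ (m ⊗ i)), (pb1 x).1 = s -> pb2 x = t ->
    (pb1 (pm_a p x)).2 = st.1 /\ pb2 (pm_a p x) = st.2.
  case: (excluded_middle_informative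
           (exists x : apex (m ∘ (m ⊗ i)), (pb1 x).1 = s /\ pb2 x = t)).
  - case=> x [e1 e2]; exists ((pb1 (pm_a p x)).2, pb2 (pm_a p x)) => y f1 f2.
    suff -> : y = x by [].
    apply: pb_ext; last by rewrite f2 e2.
    apply: pair_ext; first by rewrite f1 e1.
    have := f_equal snd (pb_eq x); have := f_equal snd (pb_eq y).
    by rewrite /= f2 e2 => -> ->.
  - by move=> N; exists (s, t) => x e1 e2; case: N; exists x.
exists (fun s t => proj1_sig (constructive_indefinite_description _ (Hx s t))).
move=> x; case: constructive_indefinite_description => st /= H; exact: H.
Qed.

Lemma actC : exists G : apex d -> apex d -> apex d * apex d,
  forall x : apex ((d ⊗ i) ∘ d),
    pb1 (pc_a c x) = (G (pb1 x) (pb2 x).1).1 /\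
    (pb2 (pc_a c x)).2 = (G (pb1 x) (pb2 x).1).2.
Proof.
have Hx (s t : apex d) : exists st : apex d * apex d,
  forall x : apex ((d ⊗ i) ∘ d), pb1 x = s -> (pb2 x).1 = t ->
    pb1 (pc_a c x) = st.1 /\ (pb2 (pc_a c x)).2 = st.2.
  case: (excluded_middle_informative
           (exists x : apex ((d ⊗ i) ∘ d), pb1 x = s /\ (pb2 x).1 = t)).
  - case=> x [e1 e2]; exists (pb1 (pc_a c x), (pb2 (pc_a c x)).2) => y f1 f2.
    suff -> : y = x by [].
    apply: pb_ext; first by rewrite f1 e1.
    apply: pair_ext; first by rewrite f2 e2.
    have := f_equal snd (pb_eq x); have := f_equal snd (pb_eq y).
    by rewrite /= f1 e1 => <- <-.
  - by move=> N; exists (s, t) => x e1 e2; case: N; exists x.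
exists (fun s t => proj1_sig (constructive_indefinite_description _ (Hx s t))).
move=> x; case: constructive_indefinite_description => st /= H; exact: H.
Qed.

Lemma star_aE F :
  (forall x : apex (m ∘ (m ⊗ i)),
    (pb1 (pm_a p x)).2 = (F (pb1 x).1 (pb2 x)).1 /\
    pb2 (pm_a p x) = (F (pb1 x).1 (pb2 x)).2) ->
  forall A B C (f : span A M) (g : span B M) (h : span C M)
    (x : apex (star p (star p f g) h)),
  [/\ (pb1 (star_a p f g h x)).1 = (pb1 (pb1 x).1).1,
      pb1 (pb1 (star_a p f g h x)).2 = ((pb1 (pb1 x).1).2, (pb1 x).2),
      pb2 (pb1 (star_a p f g h x)).2 = (F (pb2 (pb1 x).1) (pb2 x)).1
    & pb2 (star_a p f g h x) = (F (pb2 (pb1 x).1) (pb2 x)).2].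
Proof.
move=> HF A B C f g h x; split => //=.
- by rewrite (HF _).1.
- by rewrite (HF _).2.
Qed.

Lemma star2E A A' B B' (f : span A M) (f' : span A' M) (g : span B M)
    (g' : span B' M) phi psi (P : square f f' phi id) (Q : square g g' psi id) x :
  (pb1 (star2 p P Q x) = (P (pb1 x).1, Q (pb1 x).2)) *
  (pb2 (star2 p P Q x) = pb2 x).
Proof. by []. Qed.

Local Opaque star_a star2.

Lemma penA F :
  (forall x : apex (m ∘ (m ⊗ i)),
    (pb1 (pm_a p x)).2 = (F (pb1 x).1 (pb2 x)).1 /\
    pb2 (pm_a p x) = (F (pb1 x).1 (pb2 x)).2) ->
  forall s1 s2 s3 : apex m, rgt s1 = (lft s2).1 -> rgt s2 = (lft s3).1 ->
  [/\ (F s1 (F s2 s3).2).2 = (F (F s1 s2).2 s3).2,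
      (F s1 (F s2 s3).2).1 = (F (F s1 s2).1 (F (F s1 s2).2 s3).1).2
    & (F s2 s3).1 = (F (F s1 s2).1 (F (F s1 s2).2 s3).1).1].
Proof.
move=> HF s1 s2 s3 e1 e2.
have H := star_aE HF.
have E1 : @rgt _ _ (i ⊗ i) (lft s1) = lft s1 by exact: pair_ext.
pose x1 : apex (star p i i) := Pb E1.
have E2 : @rgt _ _ (star p i i ⊗ i) (x1, (lft s2).2) = lft s2 by exact: pair_ext.
pose x2 : apex (star p (star p i i) i) := Pb E2.
have E3 : @rgt _ _ (star p (star p i i) i ⊗ i) (x2, (lft s3).2) = lft s3
  by exact: pair_ext.
pose x3 : apex (star p (star p (star p i i) i) i) := Pb E3.
pose y := star_a p (star p i i) i i x3; pose z := star_a p i i (star p i i) y.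
pose w := star_a p i i i x2.
pose x4 := star2 p (star_a p i i i) (idq i) x3.
pose v := star_a p i (star p i i) i x4.
pose t := star_a p i i i (pb1 v).2.
pose r := star2 p (idq i) (star_a p i i i) v.
have E : z = r by exact: (pm_pentagon Hp x3).
have [h1 h2 h3 h4] : [/\ (pb1 y).1 = x1, True, pb2 (pb1 y).2 = (F s2 s3).1 &
  pb2 y = (F s2 s3).2] by case: (H _ _ _ _ _ _ x3).
have [k1 k2 k3 k4] := H _ _ _ _ _ _ y.
have [l1 l2 l3 l4] := H _ _ _ _ _ _ x4.
have [w1 w2 w3 w4] : [/\ True, True, pb2 (pb1 w).2 = (F s1 s2).1 &
  pb2 w = (F s1 s2).2] by case: (H _ _ _ _ _ _ x2).
have [t1 t2 t3 t4] := H _ _ _ i i i (pb1 v).2.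
have X1 : pb1 x4 = (w, (lft s3).2) by exact: (star2E _ _ _).1.
have X2 : pb2 x4 = s3 by exact: (star2E _ _ _).2.
have R1 : pb1 r = ((pb1 v).1, t) by exact: (star2E _ _ _).1.
have R2 : pb2 r = pb2 v by exact: (star2E _ _ _).2.
have S1 : pb2 x1 = s1 by [].
rewrite -/z in k1 k2 k3 k4; rewrite -/v in l1 l2 l3 l4; rewrite -/t in t1 t2 t3 t4.
clearbody r t v x4 w z y x3.
have Ea := f_equal (fun r => pb2 r) E.
have Eb := f_equal (fun r => pb2 (pb1 r).2) E.
have Ec := f_equal (fun r => pb2 (pb1 (pb1 r).2).2) E.
rewrite /= in Ea Eb Ec.
move: Ea Eb Ec; rewrite k4 k3 k2 R1 R2 /= h1 S1 h4 h3 l4 X1 X2 /= w4 t4 t3 l2 X1 /= w3 l3 X1 X2 /= w4.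
by [].
Qed.

Lemma triA F :
  (forall x : apex (m ∘ (m ⊗ i)),
    (pb1 (pm_a p x)).2 = (F (pb1 x).1 (pb2 x)).1 /\
    pb2 (pm_a p x) = (F (pb1 x).1 (pb2 x)).2) ->
  forall (s1 s2 : apex m) (u : apex j), rgt u = (lft s1).2 ->
    rgt s1 = (lft s2).1 -> (F s1 s2).2 = s2.
Proof.
move=> HF s1 s2 u e1 e2.
have E1 : @rgt _ _ (i ⊗ j) ((lft s1).1, u) = lft s1 by exact: pair_ext.
pose x1 : apex (star p i j) := Pb E1.
have E2 : @rgt _ _ (star p i j ⊗ i) (x1, (lft s2).2) = lft s2 by exact: pair_ext.
pose x2 : apex (star p (star p i j) i) := Pb E2.
pose y := star_a p i j i x2.
pose z := star2 p (idq i) (star_l p i) y.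
pose w := star2 p (star_r p i) (idq i) x2.
have E : z = w by exact: (pm_triangle Hp x2).
have [_ _ _ h] : [/\ True, True, True & pb2 y = (F s1 s2).2]
  by case: (star_aE HF x2).
have Z : pb2 z = pb2 y by exact: (star2E _ _ _).2.
have W : pb2 w = s2 by exact: (star2E _ _ _).2.
by rewrite -h -Z E W.
Qed.

Lemma costar_aE G :
  (forall x : apex ((d ⊗ i) ∘ d),
    pb1 (pc_a c x) = (G (pb1 x) (pb2 x).1).1 /\
    (pb2 (pc_a c x)).2 = (G (pb1 x) (pb2 x).1).2) ->
  forall A B C (f : span M A) (g : span M B) (h : span M C)
    (x : apex (costar c (costar c f g) h)),
  [/\ (pb2 (costar_a c f g h x)).1 = (pb2 (pb2 x).1).1,
      pb2 (pb2 (costar_a c f g h x)).2 = ((pb2 (pb2 x).1).2, (pb2 x).2),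
      pb1 (pb2 (costar_a c f g h x)).2 = (G (pb1 x) (pb1 (pb2 x).1)).2
    & pb1 (costar_a c f g h x) = (G (pb1 x) (pb1 (pb2 x).1)).1].
Proof.
move=> HG A B C f g h x; split => //=.
- by rewrite (HG _).2.
- by rewrite (HG _).1.
Qed.

Lemma costar2E A A' B B' (f : span M A) (f' : span M A') (g : span M B)
    (g' : span M B') phi psi (P : square f f' id phi) (Q : square g g' id psi) x :
  (pb2 (costar2 c P Q x) = (P (pb2 x).1, Q (pb2 x).2)) *
  (pb1 (costar2 c P Q x) = pb1 x).
Proof. by []. Qed.

Local Opaque costar_a costar2.

Lemma penC G :
  (forall x : apex ((d ⊗ i) ∘ d),
    pb1 (pc_a c x) = (G (pb1 x) (pb2 x).1).1 /\
    (pb2 (pc_a c x)).2 = (G (pb1 x) (pb2 x).1).2) ->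
  forall s1 s2 s3 : apex d, lft s1 = (rgt s2).1 -> lft s2 = (rgt s3).1 ->
  [/\ (G (G s3 s2).1 s1).1 = (G s3 (G s2 s1).1).1,
      (G (G s3 s2).1 s1).2 = (G (G s3 (G s2 s1).1).2 (G s2 s1).2).1
    & (G s3 s2).2 = (G (G s3 (G s2 s1).1).2 (G s2 s1).2).2].
Proof.
move=> HG s1 s2 s3 e1 e2.
have H := costar_aE HG.
have E1 : rgt s1 = @lft _ _ (i ⊗ i) (rgt s1) by exact: pair_ext.
pose x1 : apex (costar c i i) := Pb E1.
have E2 : rgt s2 = @lft _ _ (costar c i i ⊗ i) (x1, (rgt s2).2) by exact: pair_ext.
pose x2 : apex (costar c (costar c i i) i) := Pb E2.
have E3 : rgt s3 = @lft _ _ (costar c (costar c i i) i ⊗ i) (x2, (rgt s3).2)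
  by exact: pair_ext.
pose x3 : apex (costar c (costar c (costar c i i) i) i) := Pb E3.
pose y := costar_a c (costar c i i) i i x3.
pose z := costar_a c i i (costar c i i) y.
pose w := costar_a c i i i x2.
pose x4 := costar2 c (costar_a c i i i) (idq i) x3.
pose v := costar_a c i (costar c i i) i x4.
pose t := costar_a c i i i (pb2 v).2.
pose r := costar2 c (idq i) (costar_a c i i i) v.
have E : z = r by exact: (pc_pentagon Hc x3).
have [h1 h2 h3 h4] : [/\ (pb2 y).1 = x1, True, pb1 (pb2 y).2 = (G s3 s2).2 &
  pb1 y = (G s3 s2).1] by case: (H _ _ _ _ _ _ x3).
have [k1 k2 k3 k4] := H _ _ _ _ _ _ y.
have [l1 l2 l3 l4] := H _ _ _ _ _ _ x4.
have [w1 w2 w3 w4] : [/\ True, True, pb1 (pb2 w).2 = (G s2 s1).2 &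
  pb1 w = (G s2 s1).1] by case: (H _ _ _ _ _ _ x2).
have [t1 t2 t3 t4] := H _ _ _ i i i (pb2 v).2.
have X1 : pb2 x4 = (w, (rgt s3).2) by exact: (costar2E _ _ _).1.
have X2 : pb1 x4 = s3 by exact: (costar2E _ _ _).2.
have R1 : pb2 r = ((pb2 v).1, t) by exact: (costar2E _ _ _).1.
have R2 : pb1 r = pb1 v by exact: (costar2E _ _ _).2.
have S1 : pb1 x1 = s1 by [].
rewrite -/z in k1 k2 k3 k4; rewrite -/v in l1 l2 l3 l4; rewrite -/t in t1 t2 t3 t4.
clearbody r t v x4 w z y x3.
have Ea := f_equal (fun r => pb1 r) E.
have Eb := f_equal (fun r => pb1 (pb2 r).2) E.
have Ec := f_equal (fun r => pb1 (pb2 (pb2 r).2).2) E.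
rewrite /= in Ea Eb Ec.
move: Ea Eb Ec; rewrite k4 k3 k2 R1 R2 /= h1 S1 h4 h3 l4 X1 X2 /= w4 t4 t3 l2 X1 /= w3 l3 X1 X2 /= w4.
by [].
Qed.

Lemma triC G :
  (forall x : apex ((d ⊗ i) ∘ d),
    pb1 (pc_a c x) = (G (pb1 x) (pb2 x).1).1 /\
    (pb2 (pc_a c x)).2 = (G (pb1 x) (pb2 x).1).2) ->
  forall (s1 s2 : apex d) (u : apex e), lft u = (rgt s1).2 ->
    lft s1 = (rgt s2).1 -> (G s2 s1).1 = s2.
Proof.
move=> HG s1 s2 u e1 e2.
have E1 : rgt s1 = @lft _ _ (i ⊗ e) ((rgt s1).1, u) by exact: pair_ext.
pose x1 : apex (costar c i e) := Pb E1.
have E2 : rgt s2 = @lft _ _ (costar c i e ⊗ i) (x1, (rgt s2).2) by exact: pair_ext.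
pose x2 : apex (costar c (costar c i e) i) := Pb E2.
pose y := costar_a c i e i x2.
pose z := costar2 c (idq i) (costar_l c i) y.
pose w := costar2 c (costar_r c i) (idq i) x2.
have E : z = w by exact: (pc_triangle Hc x2).
have [_ _ _ h] : [/\ True, True, True & pb1 y = (G s2 s1).1]
  by case: (costar_aE HG x2).
have Z : pb1 z = pb1 y by exact: (costar2E _ _ _).2.
have W : pb1 w = s2 by exact: (costar2E _ _ _).2.
by rewrite -h -Z E W.
Qed.

Let cd f g (x : apex (conv f g)) := pb1 x.
Let cf f g (x : apex (conv f g)) := (pb1 (pb2 x)).1.
Let cg f g (x : apex (conv f g)) := (pb1 (pb2 x)).2.
Let cs f g (x : apex (conv f g)) := pb2 (pb2 x).

Lemma conv_ext f g (x y : apex (conv f g)) :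
  cd x = cd y -> cf x = cf y -> cg x = cg y -> cs x = cs y -> x = y.
Proof.
by move=> ? ? ? ?; apply: pb_ext => //; apply: pb_ext => //; apply: pair_ext.
Qed.

Lemma conv2E f f' g g' (u : cell f f') (v : cell g g') x :
  ((cd (conv2 u v x) = cd x) * (cf (conv2 u v x) = u (cf x)))
  * ((cg (conv2 u v x) = v (cg x)) * (cs (conv2 u v x) = cs x)).
Proof. by []. Qed.

Lemma conv_lE f (x : apex (conv conv1 f)) : conv_l f x = cg x.
Proof. by []. Qed.

Lemma conv_rE f (x : apex (conv f conv1)) : conv_r f x = cf x.
Proof. by []. Qed.

Lemma conv_rgt1 f g (x : apex (conv f g)) : (lft (cs x)).1 = rgt (cf x).
Proof. exact: (f_equal fst (esym (pb_eq (pb2 x)))). Qed.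

Lemma conv_rgt2 f g (x : apex (conv f g)) : (lft (cs x)).2 = rgt (cg x).
Proof. exact: (f_equal snd (esym (pb_eq (pb2 x)))). Qed.

Lemma conv_lft1 f g (x : apex (conv f g)) : (rgt (cd x)).1 = lft (cf x).
Proof. exact: (f_equal fst (pb_eq x)). Qed.

Lemma conv_lft2 f g (x : apex (conv f g)) : (rgt (cd x)).2 = lft (cg x).
Proof. exact: (f_equal snd (pb_eq x)). Qed.

Lemma conv_rgt f g (x : apex (conv f g)) : rgt x = rgt (cs x).
Proof. by []. Qed.

Lemma conv_lft f g (x : apex (conv f g)) : lft x = lft (cd x).
Proof. by []. Qed.

Local Transparent star_a costar_a.

Lemma conv_aE F G :
  (forall x : apex (m ∘ (m ⊗ i)),
    (pb1 (pm_a p x)).2 = (F (pb1 x).1 (pb2 x)).1 /\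
    pb2 (pm_a p x) = (F (pb1 x).1 (pb2 x)).2) ->
  (forall x : apex ((d ⊗ i) ∘ d),
    pb1 (pc_a c x) = (G (pb1 x) (pb2 x).1).1 /\
    (pb2 (pc_a c x)).2 = (G (pb1 x) (pb2 x).1).2) ->
  forall f g h (x : apex (conv (conv f g) h)),
  [/\ cd (conv_a f g h x) = (G (cd x) (cd (cf x))).1,
      cf (conv_a f g h x) = cf (cf x),
      cs (conv_a f g h x) = (F (cs (cf x)) (cs x)).2 &
      [/\ cd (cg (conv_a f g h x)) = (G (cd x) (cd (cf x))).2,
          cf (cg (conv_a f g h x)) = cg (cf x),
          cg (cg (conv_a f g h x)) = cg x &
          cs (cg (conv_a f g h x)) = (F (cs (cf x)) (cs x)).1]].
Proof.
move=> HF HG f g h x.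
have H1 : cd (conv_a f g h x) = (G (cd x) (cd (cf x))).1.
  exact: (HG _).1.
have H2 : cf (conv_a f g h x) = cf (cf x) by [].
have H3 : cg (cg (conv_a f g h x)) = cg x by [].
have H4 : cf (cg (conv_a f g h x)) = cg (cf x) by [].
have H5 : cs (conv_a f g h x) = (F (cs (cf x)) (cs x)).2.
  exact: (HF _).2.
have H6 : cd (cg (conv_a f g h x)) = (G (cd x) (cd (cf x))).2.
  exact: (HG _).2.
have H7 : cs (cg (conv_a f g h x)) = (F (cs (cf x)) (cs x)).1.
  exact: (HF _).1.
by [].
Qed.

Lemma vcomp_bij A A' A'' B B' B'' (S : span A B) (T : span A' B')
    (U : span A'' B'') phi psi phi' psi'
    (P : square S T phi psi) (Q : square T U phi' psi') :
  bijective P -> bijective Q -> bijective (P ;; Q).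
Proof. by move=> HP HQ; exact: bij_comp. Qed.

Lemma tens_bij A A' B B' C C' D D' (S : span A B) (T : span A' B')
    (S' : span C D) (T' : span C' D') phi psi phi' psi'
    (P : square S T phi psi) (P' : square S' T' phi' psi') :
  bijective P -> bijective P' -> bijective (P ⊠ P').
Proof.
case=> Q K1 K2 [Q' K1' K2']; exists (fprod Q Q') => -[x y] /=;
  by rewrite /fprod /= ?K1 ?K2 ?K1' ?K2'.
Qed.

Lemma hcomp_bij A A' B B' C C' (S : span A B) (T : span A' B')
    (S' : span B C) (T' : span B' C') phi psi psi' chi
    (Q : square S' T' psi' chi) (P : square S T phi psi) (E : psi =1 psi') :
  bijective Q -> bijective P -> injective psi' -> bijective (hcomp Q P E).
Proof.
case=> Q' K1 K2 [P' L1 L2] I.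
have HE (x : apex (T' ∘ T)) : rgt (P' (pb1 x)) = lft (Q' (pb2 x)).
  by apply: I; rewrite -E -(sq_rgt P) -(sq_lft Q) L2 K2; exact: pb_eq.
exists (fun x => Pb (HE x)) => x; apply: pb_ext => /=; by rewrite ?K1 ?K2 ?L1 ?L2.
Qed.

Lemma cell_iso f g (u : cell f g) :
  bijective u -> is_iso conv_id conv_cmp u.
Proof.
case=> v K1 K2; unshelve eexists (@Square _ _ _ _ g f id id v _ _).
- by move=> s; rewrite -{2}(K2 s) sq_lft.
- by move=> s; rewrite -{2}(K2 s) sq_rgt.
- by split; apply: cell_ext.
Qed.

Lemma snd_unit_inj A : injective (@snd unit A).
Proof. by case=> -[] ? [[] ?] /= ->. Qed.

Lemma fst_unit_inj A : injective (@fst A unit).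
Proof. by case=> ? [] [? []] /= ->. Qed.

Lemma idq_bij A B (f : span A B) : bijective (idq f).
Proof. by exists id. Qed.

Lemma comp_1r_bij A B (f : span A B) :
  bijective (comp_1r f) /\ bijective (comp_1rV f).
Proof.
have K : cancel (comp_1r f) (comp_1rV f).
  by move=> x; apply: pb_ext => //=; exact: esym (pb_eq x).
have L : cancel (comp_1rV f) (comp_1r f) by [].
by split; [exists (comp_1rV f) | exists (comp_1r f)].
Qed.

Lemma comp_1l_bij A B (f : span A B) :
  bijective (comp_1l f) /\ bijective (comp_1lV f).
Proof.
have K : cancel (comp_1l f) (comp_1lV f).
  by move=> x; apply: pb_ext => //=; exact: (pb_eq x).
have L : cancel (comp_1lV f) (comp_1l f) by [].
by split; [exists (comp_1lV f) | exists (comp_1l f)].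
Qed.

Lemma interchange_bij A B C A' B' C' (g : span B C) (f : span A B)
    (g' : span B' C') (f' : span A' B') :
  bijective (interchange g f g' f') /\ bijective (interchangeV g f g' f').
Proof.
have K : cancel (interchange g f g' f') (interchangeV g f g' f').
  by move=> x; apply: pb_ext; apply: pair_ext.
have L : cancel (interchangeV g f g' f') (interchange g f g' f').
  by move=> x; apply: pair_ext; apply: pb_ext.
by split; [exists (interchangeV g f g' f') | exists (interchange g f g' f')].
Qed.

Lemma comp_assoc_bij A B C D (h : span C D) (g : span B C) (f : span A B) :
  bijective (comp_assoc h g f) /\ bijective (comp_assocV h g f).
Proof.
have K : cancel (comp_assoc h g f) (comp_assocV h g f).
  by move=> x; do 2 apply: pb_ext => //.
have L : cancel (comp_assocV h g f) (comp_assoc h g f).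
  by move=> x; do 2 apply: pb_ext => //.
by split; [exists (comp_assocV h g f) | exists (comp_assoc h g f)].
Qed.

Lemma tassoc_bij A B C A' B' C' (f : span A A') (g : span B B') (h : span C C') :
  bijective (tassoc f g h).
Proof. by exists (tassocV f g h); [exact: assocK | exact: assocVK]. Qed.

Lemma tsnd_bij A B (f : span A B) : bijective (tsnd (one unit) f).
Proof. by exists (fun x => (tt, x)) => // -[[]]. Qed.

Lemma tfst_bij A B (f : span A B) : bijective (tfst f (one unit)).
Proof. by exists (fun x => (x, tt)) => // -[? []]. Qed.

Lemma recast_bij A A' B B' (S : span A B) (T : span A' B') phi phi' psi psi'
    (P : square S T phi psi) (e1 : phi =1 phi') (e2 : psi =1 psi') :
  bijective P -> bijective (recast P e1 e2).
Proof. by []. Qed.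

Lemma assoc_inj A B C : injective (@assoc A B C).
Proof. exact: can_inj (@assocK A B C). Qed.

Lemma id_inj A : injective (@id A).
Proof. by []. Qed.

Lemma idid_inj A B : injective (@id A × @id B).
Proof. by move=> [? ?] [? ?]. Qed.

Ltac bij := repeat lazymatch goal with
  | |- @injective _ _ (@assoc _ _ _) => refine (@assoc_inj _ _ _)
  | |- @injective _ _ (@snd _ _) => exact: snd_unit_inj
  | |- @injective _ _ (@fst _ _) => exact: fst_unit_inj
  | |- injective (fprod _ _) => exact: idid_inj
  | |- injective _ => exact: id_inj
  | |- bijective (sqfun ?P) => lazymatch P with
    | recast _ _ _ => refine (recast_bij _ _ _)
    | vcomp _ _ => apply: vcomp_bij
    | hcomp _ _ _ => apply: hcomp_bij
    | tens _ _ => apply: tens_bij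
    | idq _ => exact: idq_bij
    | comp_1r _ => exact: (comp_1r_bij _).1
    | comp_1rV _ => exact: (comp_1r_bij _).2
    | comp_1l _ => exact: (comp_1l_bij _).1
    | comp_1lV _ => exact: (comp_1l_bij _).2
    | interchange _ _ _ _ => exact: (interchange_bij _ _ _ _).1
    | interchangeV _ _ _ _ => exact: (interchange_bij _ _ _ _).2
    | comp_assoc _ _ _ => exact: (comp_assoc_bij _ _ _).1
    | comp_assocV _ _ _ => exact: (comp_assoc_bij _ _ _).2
    | tassoc _ _ _ => exact: tassoc_bij
    | tsnd _ _ => exact: tsnd_bij
    | tfst _ _ => exact: tfst_bij
    | pm_a _ => exact: (pm_a_iso Hp)
    | pm_l _ => exact: (pm_l_iso Hp)
    | pm_r _ => exact: (pm_r_iso Hp)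
    | pc_a _ => exact: (pc_a_iso Hc)
    | pc_l _ => exact: (pc_l_iso Hc)
    | pc_r _ => exact: (pc_r_iso Hc)
    | star_a _ _ _ _ => unfold star_a
    | star_l _ _ => unfold star_l
    | star_r _ _ => unfold star_r
    | conv_a _ _ _ => unfold conv_a
    | conv_l _ => unfold conv_l
    | conv_r _ => unfold conv_r
    end end.

Lemma star_a_bij A B C (f : span A M) (g : span B M) (h : span C M) :
  bijective (star_a p f g h).
Proof. bij. Qed.

Lemma star_l_bij B (g : span B M) : bijective (star_l p g).
Proof. bij. Qed.

Lemma star_r_bij B (g : span B M) : bijective (star_r p g).
Proof. bij. Qed.

Lemma conv_a_bij f g h : bijective (conv_a f g h).
Proof. bij. Qed.

Lemma conv_l_bij f : bijective (conv_l f).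
Proof. bij. Qed.

Lemma conv_r_bij f : bijective (conv_r f).
Proof. bij. Qed.

Local Opaque conv_a conv2.

Lemma conv_nat f g h f' g' h' (u : cell f f') (v : cell g g') (w : cell h h') :
  conv2 (conv2 u v) w ;; conv_a f' g' h' =1 conv_a f g h ;; conv2 u (conv2 v w).
Proof.
have [F HF] := actA; have [G HG] := actC => x.
pose y := conv2 (conv2 u v) w x; pose z := conv_a f g h x.
have [y1 y2] := conv2E (conv2 u v) w x; rewrite -/y in y1 y2.
have [y3 y4] := conv2E u v (cf x).
have [z1 z2] := conv2E u (conv2 v w) z.
have [z3 z4] := conv2E v w (cg z).
have [a1 a2 a3 [a4 a5 a6 a7]] := conv_aE HF HG y.
have [b1 b2 b3 [b4 b5 b6 b7]] := conv_aE HF HG x.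
rewrite -/z in b1 b2 b3 b4 b5 b6 b7.
change (conv_a f' g' h' y = conv2 u (conv2 v w) z).
apply: conv_ext; last 2 first.
- apply: conv_ext.
  + by rewrite a4 z2 z3 b4 y1 y1 y3.
  + by rewrite a5 z2 z3 b5 y1 y4.
  + by rewrite a6 z2 z4 b6 y2.
  + by rewrite a7 z2 z4 b7 y1 y2 y4.
- by rewrite a3 z2 b3 y1 y2 y4.
- by rewrite a1 z1 b1 y1 y1 y3.
- by rewrite a2 z1 b2 y1 y3.
Qed.

Lemma conv_pentagon f g h k :
  conv_a (conv f g) h k ;; conv_a f g (conv h k)
  =1 conv2 (conv_a f g h) (conv_id k) ;; conv_a f (conv g h) k
     ;; conv2 (conv_id f) (conv_a g h k).
Proof.
have [F HF] := actA; have [G HG] := actC => x.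
have A := conv_aE HF HG.
pose y := conv_a (conv f g) h k x; pose z := conv_a f g (conv h k) y.
pose w := conv_a f g h (cf x).
pose x' := conv2 (conv_a f g h) (conv_id k) x.
pose v := conv_a f (conv g h) k x'.
pose t := conv_a g h k (cg v).
pose r := conv2 (conv_id f) (conv_a g h k) v.
change (z = r).
have [y1 y2 y3 [y4 y5 y6 y7]] := A _ _ _ x; rewrite -/y in y1 y2 y3 y4 y5 y6 y7.
have [z1 z2 z3 [z4 z5 z6 z7]] := A _ _ _ y; rewrite -/z in z1 z2 z3 z4 z5 z6 z7.
have [w1 w2 w3 [w4 w5 w6 w7]] := A _ _ _ (cf x); rewrite -/w in w1 w2 w3 w4 w5 w6 w7.
have [v1 v2 v3 [v4 v5 v6 v7]] := A _ _ _ x'; rewrite -/v in v1 v2 v3 v4 v5 v6 v7.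
have [t1 t2 t3 [t4 t5 t6 t7]] := A _ _ _ (cg v); rewrite -/t in t1 t2 t3 t4 t5 t6 t7.
have X : ((cd x' = cd x) * (cf x' = w)) * ((cg x' = cg x) * (cs x' = cs x))
  by exact: (conv2E _ _ x).
have R : ((cd r = cd v) * (cf r = cf v)) * ((cg r = t) * (cs r = cs v))
  by exact: (conv2E _ _ v).
have [p1 p2 p3] : [/\ _, _ & _] := penA HF
  (etrans (esym (conv_rgt (cf (cf x)))) (esym (conv_rgt1 (cf x))))
  (etrans (esym (conv_rgt (cf x))) (esym (conv_rgt1 x))).
have [q1 q2 q3] : [/\ _, _ & _] := penC HG
  (esym (etrans (conv_lft1 (cf x)) (conv_lft (cf (cf x)))))
  (esym (etrans (conv_lft1 x) (conv_lft (cf x)))).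
clearbody r t v x' w z y.
case: X => -[X1 X2] [X3 X4]; case: R => -[R1 R2] [R3 R4].
apply: conv_ext; last 2 first.
- rewrite R3; apply: conv_ext; last 2 first.
  + apply: conv_ext.
    * by rewrite z6 y4 t4 v4 v5 X1 X2 w4 w1 q3.
    * by rewrite z6 y5 t5 v5 X2 w6.
    * by rewrite z6 y6 t6 v6 X3.
    * by rewrite z6 y7 t7 v5 v7 X2 X4 w7 w3 p3.
  + by rewrite z7 y2 y3 t3 v5 v7 X2 X4 w7 w3 p2.
  + by rewrite z4 y1 y2 t1 v4 v5 X1 X2 w4 w1 q2.
  + by rewrite z5 y2 t2 v5 X2 w5.
- by rewrite z3 y2 y3 R4 v3 X2 X4 w3 p1.
- by rewrite z1 y1 y2 R1 v1 X1 X2 w1 q1.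
- by rewrite z2 y2 R2 v2 X2 w2.
Qed.

Lemma conv_triangle f g :
  conv_a f conv1 g ;; conv2 (conv_id f) (conv_l g)
  =1 conv2 (conv_r f) (conv_id g).
Proof.
have [F HF] := actA; have [G HG] := actC => x.
pose y := conv_a f conv1 g x.
change (conv2 (conv_id f) (conv_l g) y = conv2 (conv_r f) (conv_id g) x).
have [y1 y2 y3 [y4 y5 y6 y7]] := conv_aE HF HG x.
rewrite -/y in y1 y2 y3 y4 y5 y6 y7.
have [a1 a2] := conv2E (conv_id f) (conv_l g) y.
have [b1 b2] := conv2E (conv_r f) (conv_id g) x.
apply: conv_ext.
- rewrite a1 b1 y1.
  apply: (triC HG (u := pb1 (cg (cf x)))); last by rewrite conv_lft1.
  by rewrite conv_lft2.
- by rewrite a1 b1 y2 conv_rE.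
- by rewrite a2 b2 conv_lE y6.
- rewrite a2 b2 y3.
  apply: (triA HF (u := pb2 (cg (cf x)))); last by rewrite conv_rgt1.
  by rewrite conv_rgt2.
Qed.

Definition convolution : moncat.
Proof.
refine (@Moncat (span M M) (fun f g => cell f g) conv_id conv_cmp conv
  (fun f f' g g' u v => conv2 u v) conv1 conv_a conv_l conv_r
  _ _ _ _ _ _ _ _ _ _ _ _ _).
- by move=> *; exact: cell_ext.
- by move=> *; exact: cell_ext.
- by move=> *; exact: cell_ext.
- by move=> f g; apply: cell_ext => x; apply: conv_ext; rewrite conv2E.
- move=> f g h f' g' h' v u v' u'; apply: cell_ext => x.
  by apply: conv_ext; rewrite /conv_cmp /= !conv2E.
- by move=> *; apply: cell_iso; exact: conv_a_bij.
- by move=> *; apply: cell_iso; exact: conv_l_bij.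
- by move=> *; apply: cell_iso; exact: conv_r_bij.
- by move=> *; apply: cell_ext; exact: conv_nat.
- by move=> f g u; apply: cell_ext => x; exact: (conv2E (conv_id conv1) u x).2.1.
- by move=> f g u; apply: cell_ext => x; exact: (conv2E u (conv_id conv1) x).1.2.
- by move=> *; apply: cell_ext => x; exact: conv_pentagon.
- by move=> *; apply: cell_ext => x; exact: conv_triangle.
Defined.

End Convolution.

Transparent star2 costar2 conv_a conv2.

Definition oplax_antipode M (B : oplax_bimonoid M) : Type :=
  @oplax_inverse (convolution (ob_monP B) (ob_comP B)) (one M).

Record oplax_hopf_monoid (M : Type) := OplaxHopfMonoid {
  hm_bimonoid : oplax_bimonoid M;
  hm_antipode : oplax_antipode hm_bimonoid }.

Section PairBimonoid.
Variable X : Type.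
Local Notation X2 := (X * X)%type.
Local Notation i := (one X2).

Definition pair_mu : span (X2 * X2) X2 :=
  @Span (X2 * X2) X2 (X * X * X)
    (fun t => ((t.1.1, t.1.2), (t.1.2, t.2))) (fun t => (t.1.1, t.2)).

Definition pair_eta : span unit X2 :=
  @Span unit X2 X (fun=> tt) (fun x => (x, x)).

Definition pair_zeta : span X2 (X2 * X2) := graph (fun p => (p, p)).

Definition pair_nu : span X2 unit := graph (fun=> tt).

Ltac crush :=
  intros; simpl in *;
  repeat match goal with
  | e : pullback _ _ |- _ => destruct e; unfold fprod in *; simpl in *
  | x : (_ * _)%type |- _ => destruct x; simpl in *
  | x : unit |- _ => destruct x; simpl in *
  | H : _ = _ :> _ * _ |- _ => injection H; clear H; intros; subst; simpl in *
  end; try subst; try reflexivity.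

Definition pair_a :
  square (pair_mu ∘ (pair_mu ⊗ i)) (pair_mu ∘ (i ⊗ pair_mu)) (@assoc X2 X2 X2) id.
Proof.
unshelve eexists.
- move=> e; pose t := (pb1 e).1; pose w := (pb1 e).2.2.
  by exists ((t.1.1, t.1.2), (t.1.2, t.2, w)) (t.1.1, t.1.2, w).
- by crush.
- by crush.
Defined.

Definition pair_l : square (pair_mu ∘ (pair_eta ⊗ i)) i snd id.
Proof.
unshelve eexists.
- exact: (fun e => (pb1 e).2).
- by crush.
- by crush.
Defined.

Definition pair_r : square (pair_mu ∘ (i ⊗ pair_eta)) i fst id.
Proof.
unshelve eexists.
- exact: (fun e => (pb1 e).1).
- by crush.
- by crush.
Defined.

Definition pair_mon : psmon_data X2 := PsmonData pair_a pair_l pair_r.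

Definition pair_ca :
  square ((pair_zeta ⊗ i) ∘ pair_zeta) ((i ⊗ pair_zeta) ∘ pair_zeta)
    id (@assoc X2 X2 X2).
Proof.
unshelve eexists.
- by move=> e; exists (pb1 e) (pb1 e, pb1 e).
- by [].
- by crush.
Defined.

Definition pair_cl : square ((pair_nu ⊗ i) ∘ pair_zeta) i id snd.
Proof.
unshelve eexists.
- exact: (fun e => pb1 e).
- by [].
- by crush.
Defined.

Definition pair_cr : square ((i ⊗ pair_nu) ∘ pair_zeta) i id fst.
Proof.
unshelve eexists.
- exact: (fun e => pb1 e).
- by [].
- by crush.
Defined.

Definition pair_com : pscom_data X2 := PscomData pair_ca pair_cl pair_cr.

Definition pair_theta :
  cell (pair_zeta ∘ pair_mu)
    (pm_m (pair_mon ⊗m pair_mon) ∘ (pair_zeta ⊗ pair_zeta)).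
Proof.
unshelve eexists.
- move=> e; pose t : X * X * X := pb1 e.
  unshelve eexists (@lft _ _ pair_mu t) _.
  + by unshelve eexists ((t.1.1, t.1.2, (t.1.1, t.1.2), (t.1.2, t.2, (t.1.2, t.2)))) (t, t).
  + by [].
- by [].
- by crush.
Defined.

Definition pair_theta0 :
  cell (pair_zeta ∘ pair_eta) (pm_j (pair_mon ⊗m pair_mon)).
Proof.
unshelve eexists.
- by move=> e; exists tt (pb1 e, pb1 e).
- by [].
- by crush.
Defined.

Definition pair_chi :
  cell (pair_nu ∘ pair_mu) (pm_m unit_psmon ∘ (pair_nu ⊗ pair_nu)).
Proof.
unshelve eexists.
- by move=> e; exists (@lft _ _ pair_mu (pb1 e)) (tt, tt).
- by [].
- by crush.
Defined.

Definition pair_chi0 : cell (pair_nu ∘ pair_eta) (one unit).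
Proof.
unshelve eexists.
- exact: (fun=> tt).
- by [].
- by crush.
Defined.

Definition lmono A B (S : span A B) := injective (@lft A B S).
Definition rmono A B (S : span A B) := injective (@rgt A B S).
Definition jmono A B (S : span A B) :=
  forall s t : apex S, lft s = lft t -> rgt s = rgt t -> s = t.

Lemma lmono_j A B (S : span A B) : lmono S -> jmono S.
Proof. by move=> H s t /H. Qed.

Lemma rmono_j A B (S : span A B) : rmono S -> jmono S.
Proof. by move=> H s t _ /H. Qed.

Lemma lmono_comp A B C (g : span B C) (f : span A B) :
  lmono g -> lmono f -> lmono (g ∘ f).
Proof.
move=> Hg Hf x y /= /Hf e; apply: pb_ext => //.
by apply: Hg; rewrite -!pb_eq e.
Qed.

Lemma rmono_comp A B C (g : span B C) (f : span A B) :
  rmono g -> rmono f -> rmono (g ∘ f).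
Proof.
move=> Hg Hf x y /= /Hg e; apply: pb_ext => //.
by apply: Hf; rewrite !pb_eq e.
Qed.

Lemma lmono_tensor A B C D (g : span C D) (f : span A B) :
  lmono g -> lmono f -> lmono (g ⊗ f).
Proof. by move=> Hg Hf [? ?] [? ?] [/Hg -> /Hf ->]. Qed.

Lemma rmono_tensor A B C D (g : span C D) (f : span A B) :
  rmono g -> rmono f -> rmono (g ⊗ f).
Proof. by move=> Hg Hf [? ?] [? ?] [/Hg -> /Hf ->]. Qed.

Lemma lmono_graph A B (f : A -> B) : lmono (graph f).
Proof. by []. Qed.

Lemma rmono_graph A B (f : A -> B) : injective f -> rmono (graph f).
Proof. by []. Qed.

Lemma lmono_mu : lmono pair_mu.
Proof. by move=> [[? ?] ?] [[? ?] ?] /= [-> -> _ ->]. Qed.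

Lemma rmono_eta : rmono pair_eta.
Proof. by move=> ? ? /= [->]. Qed.

Lemma dup_inj : injective dup. Proof. by case=> -[]. Qed.

Lemma jmono_eq A A' B B' (S : span A B) (T : span A' B') phi psi phi' psi'
    (P : square S T phi psi) (Q : square S T phi' psi') :
  jmono T -> phi =1 phi' -> psi =1 psi' -> P =1 Q.
Proof. by move=> H e e' s; apply: H; rewrite ?sq_lft ?sq_rgt ?e ?e'. Qed.

Ltac mono :=
  solve [ apply: lmono_j; repeat first
    [ exact: lmono_mu | exact: lmono_graph | apply: lmono_tensor | apply: lmono_comp ]
  | apply: rmono_j; repeat first
    [ exact: rmono_eta | exact: dup_inj | apply: rmono_tensor | apply: rmono_comp ] ].

Ltac by_mono :=
  cbv zeta;
  match goal with |- eqfun (sqfun ?P) (sqfun ?Q) =>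
    refine (@jmono_eq _ _ _ _ _ _ _ _ _ _ P Q _ _ _)
  end; [mono | boundary | boundary].

Lemma pair_monP : is_psmon pair_mon.
Proof.
split.
- unshelve eexists.
  + move=> e; pose t := (pb1 e).2; pose w := (pb1 e).1.1.
    exists ((w, t.1.1, t.1.2), (t.1.2, t.2)) (w, t.1.2, t.2).
    by [].
  + by move=> e; crush; apply: pb_ext; crush.
  + by move=> e; crush; apply: pb_ext; crush.
- unshelve eexists.
  + by move=> p; exists (p.1, p) (p.1, p.1, p.2); case: p.
  + by move=> e; crush; apply: pb_ext; crush.
  + by move=> e; crush.
- unshelve eexists.
  + by move=> p; exists (p, p.2) (p.1, p.2, p.2); case: p.
  + by move=> e; crush; apply: pb_ext; crush.
  + by move=> e; crush.
- by by_mono.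
- by by_mono.
Qed.

Lemma pair_comP : is_pscom pair_com.
Proof.
split.
- unshelve eexists.
  + by move=> e; exists (pb1 e) (pb1 e, pb1 e).
  + by move=> e; crush; apply: pb_ext; crush.
  + by move=> e; crush; apply: pb_ext; crush.
- unshelve eexists.
  + by move=> p; exists p (p, p).
  + by move=> e; crush; apply: pb_ext; crush.
  + by move=> e; crush.
- unshelve eexists.
  + by move=> p; exists p (p, p).
  + by move=> e; crush; apply: pb_ext; crush.
  + by move=> e; crush.
- by by_mono.
- by by_mono.
Qed.

Definition pair_bimonoid : oplax_bimonoid X2.
Proof.
refine (@OplaxBimonoid X2 pair_mon pair_com pair_theta pair_theta0 pair_chi pair_chi0
  pair_monP pair_comP _ _ _ _ _).
- by split; by_mono.
- by split; by_mono.
- by split; by_mono.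
- by split; by_mono.
- by split; by_mono.
Defined.

End PairBimonoid.

(* Main.v *)
(** A span from X² to X² is a family of directed graphs on X indexed by the
    points p = (a, b) of X², and convolution is the composition of graphs at
    each p.  The identity span has the single edge a → b at p, and the unit has
    one loop at each vertex.  The antipode is the span (id, sw), with the single
    edge b → a at p.

    Let Q be any oplax inverse.  Since Q ⊙ 1 ⊙ Q → Q ⊙ I is surjective, every
    edge of Q at p ends at a; then τ₂ shows that it starts at b.  The equation
    1_Q ⊗ τ₁ = τ₂ ⊗ 1_Q identifies any two edges b → a at p, and there is one
    since (1 ⊙ Q) ⊙ 1 → I ⊙ 1 is surjective.  So Q has exactly the edge b → a at
    each p, and compatibility with τ₁ and τ₂ is automatic because 2-cells into
    the unit are unique. *)
From mathcomp Require Import ssreflect ssrfun ssrbool.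
From Stdlib Require Import ClassicalEpsilon.
Require Import Defs.

Set Implicit Arguments.
Unset Strict Implicit.
Unset Printing Implicit Defensive.

Lemma inj_surj_bij A B (f : A -> B) :
  injective f -> (forall b, exists a, f a = b) -> bijective f.
Proof.
move=> I s; exists (fun b => proj1_sig (constructive_indefinite_description _ (s b))).
- by move=> a; apply: I; case: constructive_indefinite_description.
- by move=> b; case: constructive_indefinite_description.
Qed.

(** A 2-cell commutes with left legs, so the inverse of [u] must be the left leg of [T] followed by
    the inverse of the left leg of [S]. *)
Lemma lft_bij_iso M (S T : span M M) (u : cell S T) :
  bijective (@lft _ _ S) -> lmono T -> is_iso (@conv_id M) (@conv_cmp M) u.
Proof.
case=> g K L I; apply: cell_iso; exists (g \o lft) => s /=.
- by rewrite sq_lft K.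
- by apply: I; rewrite sq_lft /= L.
Qed.

Lemma iso_surj M (S T : span M M) (u : cell S T) :
  is_iso (@conv_id M) (@conv_cmp M) u -> forall t, exists s, u s = t.
Proof.
by case=> v [_ e] t; exists (v t); exact: (f_equal (fun k : cell T T => k t) e).
Qed.

Lemma jmono_cell A B (S T : span A B) (u v : cell S T) : jmono T -> u = v.
Proof. by move=> J; apply: cell_ext; exact: jmono_eq. Qed.

Section Pair.
Variable X : Type.
Local Notation X2 := (X * X)%type.
Local Notation "f ⊙ g" := (conv (pair_mon X) (pair_com X) f g)
  (at level 40, left associativity).
Local Notation unitc := (conv1 (pair_mon X) (pair_com X)).

Section Elements.
Variables f g : span X2 X2.

(** An edge of [f ⊙ g] at a point is an edge of [f] followed by a composable edge of [g] at that
    point; the next definitions extract these factors and compose them. *)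
Definition conv_l_elt (x : apex (f ⊙ g)) : apex f := (pb1 (pb2 x)).1.
Definition conv_r_elt (x : apex (f ⊙ g)) : apex g := (pb1 (pb2 x)).2.

Definition conv_elt (s : apex f) (t : apex g) (e : lft s = lft t)
  (e' : (rgt s).2 = (rgt t).1) : apex (f ⊙ g).
Proof.
unshelve eexists.
- exact: (lft s).
- unshelve eexists; first exact: (s, t).
  + exact: ((rgt s).1, (rgt s).2, (rgt t).2).
  + by apply: pair_ext; apply: pair_ext.
- by apply: pair_ext.
Defined.

Lemma lft_conv_l (x : apex (f ⊙ g)) : lft (conv_l_elt x) = lft x.
Proof. exact: (esym (f_equal fst (pb_eq x))). Qed.

Lemma lft_conv_r (x : apex (f ⊙ g)) : lft (conv_r_elt x) = lft x.
Proof. exact: (esym (f_equal snd (pb_eq x))). Qed.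

Lemma rgt_conv_l (x : apex (f ⊙ g)) : (rgt (conv_l_elt x)).1 = (rgt x).1.
Proof. exact: (f_equal (fun z => z.1.1) (pb_eq (pb2 x))). Qed.

Lemma rgt_conv_r (x : apex (f ⊙ g)) : (rgt (conv_r_elt x)).2 = (rgt x).2.
Proof. exact: (f_equal (fun z => z.2.2) (pb_eq (pb2 x))). Qed.

Lemma conv_mid (x : apex (f ⊙ g)) :
  (rgt (conv_l_elt x)).2 = (rgt (conv_r_elt x)).1.
Proof.
exact: etrans (f_equal (fun z => z.1.2) (pb_eq (pb2 x)))
  (esym (f_equal (fun z => z.2.1) (pb_eq (pb2 x)))).
Qed.

(** The other components, a point of X² and a triple in the apex of [pair_mu], are fixed by the
    factors because [pair_zeta] and [pair_mu] have injective left legs. *)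
Lemma conv_elt_ext (x y : apex (f ⊙ g)) :
  conv_l_elt x = conv_l_elt y -> conv_r_elt x = conv_r_elt y -> x = y.
Proof.
move=> el er; have e : pb1 (pb2 x) = pb1 (pb2 y) by exact: pair_ext.
apply: pb_ext; first by rewrite -[pb1 x](lft_conv_l x) el; exact: lft_conv_l.
apply: pb_ext => //; apply: (@lmono_mu X).
by rewrite -!pb_eq e.
Qed.

(** One edge of [f] and one of [g] at each point, always composable, give exactly one composite
    there. *)
Lemma conv_lft_bij :
  bijective (@lft _ _ f) -> bijective (@lft _ _ g) ->
  (forall s t, @lft _ _ f s = @lft _ _ g t -> (rgt s).2 = (rgt t).1) ->
  bijective (@lft _ _ (f ⊙ g)).
Proof.
case=> h K L [k K' L'] H.
have E p : lft (h p) = lft (k p) by rewrite L L'.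
exists (fun p => conv_elt (E p) (H _ _ (E p))).
- move=> x; apply: conv_elt_ext.
  + by apply: (can_inj K); rewrite L lft_conv_l.
  + by apply: (can_inj K'); rewrite L' lft_conv_r.
- by move=> p; rewrite /= L.
Qed.

End Elements.

Lemma unit_jmono : jmono unitc.
Proof. by move=> s t /= es [et]; apply: pb_ext. Qed.

Lemma unit_loop (y : apex unitc) : (rgt y).1 = (rgt y).2.
Proof. by []. Qed.

(** The loop at the vertex [x] in the graph indexed by [p]. *)
Definition unit_elt (p : X2) (x : X) : apex unitc :=
  @Pb _ _ _ (@rgt _ _ (pair_nu X)) (@lft _ _ (pair_eta X)) p x erefl.

(** The right unit constraint is a bijection over the identity, so it transports injectivity of the
    left leg. *)
Lemma conv_unitr_lmono f : lmono f -> lmono (f ⊙ unitc).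
Proof.
move=> I x y e.
apply: (bij_inj (conv_r_bij (pair_monP X) (pair_comP X) f)); apply: I.
by rewrite !sq_lft e.
Qed.

Lemma conv_unitl_lmono f : lmono f -> lmono (unitc ⊙ f).
Proof.
move=> I x y e.
apply: (bij_inj (conv_l_bij (pair_monP X) (pair_comP X) f)); apply: I.
by rewrite !sq_lft e.
Qed.

Definition swap_span : span X2 X2 := graph (fun p => (p.2, p.1)).

Lemma one_lft_bij : bijective (@lft _ _ (one X2)).
Proof. by exists id. Qed.

Lemma swap_lft_bij : bijective (@lft _ _ swap_span).
Proof. by exists id. Qed.

Lemma one_swap_lft_bij : bijective (@lft _ _ (one X2 ⊙ swap_span)).
Proof.
by apply: (conv_lft_bij one_lft_bij swap_lft_bij) => s t /= ->.
Qed.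

Lemma swap_one_lft_bij : bijective (@lft _ _ (swap_span ⊙ one X2)).
Proof.
by apply: (conv_lft_bij swap_lft_bij one_lft_bij) => s t /= ->.
Qed.

Definition swap_tau1 : cell (one X2 ⊙ swap_span) unitc.
Proof.
(* Over (a, b) the composite is a → b → a, so [(rgt x).1] is the vertex a of the loop. *)
exists (fun x => unit_elt (lft x) (rgt x).1) => // x.
have el : conv_l_elt x = lft x :> X2 := lft_conv_l x.
have er : conv_r_elt x = lft x :> X2 := lft_conv_r x.
by apply: pair_ext => //; rewrite -rgt_conv_r -rgt_conv_l /= el er.
Defined.

Definition swap_tau2 : cell (swap_span ⊙ one X2) unitc.
Proof.
exists (fun x => unit_elt (lft x) (rgt x).1) => // x.
have el : conv_l_elt x = lft x :> X2 := lft_conv_l x.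
have er : conv_r_elt x = lft x :> X2 := lft_conv_r x.
by apply: pair_ext => //; rewrite -rgt_conv_r -rgt_conv_l /= el er.
Defined.

Definition pair_antipode : oplax_antipode (pair_bimonoid X).
Proof.
refine (@OplaxInverse (convolution (pair_monP X) (pair_comP X)) (one X2)
  swap_span swap_tau1 swap_tau2 _ _ _ _ _ _).
(* Both equations compare 2-cells into a span with injective left leg, where parallel 2-cells
   agree. *)
- exact/jmono_cell/lmono_j.
- exact/jmono_cell/lmono_j.
(* For each of the four whiskered 2-cells, the source is a threefold composite with one edge at each
   point, and the target has an injective left leg. *)
- apply: lft_bij_iso; last exact: conv_unitr_lmono.
  apply: (conv_lft_bij swap_lft_bij one_swap_lft_bij) => s t.
  by rewrite -rgt_conv_l -lft_conv_l => /= ->.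
- apply: lft_bij_iso; last exact: conv_unitl_lmono.
  apply: (conv_lft_bij swap_one_lft_bij swap_lft_bij) => s t.
  by rewrite -rgt_conv_r -lft_conv_r => /= ->.
- apply: lft_bij_iso; last exact: conv_unitl_lmono.
  apply: (conv_lft_bij one_swap_lft_bij one_lft_bij) => s t.
  by rewrite -rgt_conv_r -lft_conv_r => /= ->.
- apply: lft_bij_iso; last exact: conv_unitr_lmono.
  apply: (conv_lft_bij one_lft_bij swap_one_lft_bij) => s t.
  by rewrite -rgt_conv_l -lft_conv_l => /= ->.
Defined.

Section Unique.
Variable s : oplax_antipode (pair_bimonoid X).
Let Q : span X2 X2 := oi_obj s.
Let tau1 : cell (one X2 ⊙ Q) unitc := oi_tau1 s.
Let tau2 : cell (Q ⊙ one X2) unitc := oi_tau2 s.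

Lemma antipode_source (q : apex Q) :
  (rgt q).2 = (lft q).1 -> (rgt q).1 = (lft q).2.
Proof.
(* Write (a, b) for [lft q]: [x] is [q] followed by a → b, and [tau2] sends it to a loop with the
   same endpoints. *)
move=> e; pose x : apex (Q ⊙ one X2) := @conv_elt Q (one X2) q (lft q) erefl e.
by have := unit_loop (tau2 x); rewrite sq_rgt.
Qed.

Lemma antipode_target (q : apex Q) : (rgt q).2 = (lft q).1.
Proof.
(* [z] is [q] followed by the loop at its target. In a preimage [w], [q] is followed by an edge of
   [one X2 ⊙ Q], which must start at a. *)
pose z : apex (Q ⊙ unitc) :=
  @conv_elt Q unitc q (unit_elt (lft q) (rgt q).2) erefl erefl.
have [w ew] := iso_surj (oi_iso1l s) z.
have el : conv_l_elt (w : apex (Q ⊙ (one X2 ⊙ Q))) = q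
  by exact: (f_equal (fun z : apex (Q ⊙ unitc) => conv_l_elt z) ew).
rewrite -el (conv_mid (w : apex (Q ⊙ (one X2 ⊙ Q)))) -rgt_conv_l.
rewrite (lft_conv_l (w : apex (Q ⊙ (one X2 ⊙ Q)))).
by rewrite -(lft_conv_r (w : apex (Q ⊙ (one X2 ⊙ Q)))) -lft_conv_l.
Qed.

Lemma antipode_rgt (q : apex Q) : rgt q = ((lft q).2, (lft q).1).
Proof.
by apply: pair_ext; [apply: antipode_source|]; exact: antipode_target.
Qed.

Lemma antipode_lft_inj : injective (@lft _ _ Q).
Proof.
move=> q q' e.
have e1 : (lft q).2 = (rgt q').1 by rewrite antipode_rgt e.
(* On [w], made of [q], a → b and [q'], the side of [oi_eq1] with [tau1] returns [q] and the side
   with [tau2] returns [q']. *)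
pose w : apex (Q ⊙ one X2 ⊙ Q) := @conv_elt (Q ⊙ one X2) Q
  (@conv_elt Q (one X2) q (lft q) erefl (antipode_target q)) q' e e1.
exact: (f_equal (fun k : cell (Q ⊙ one X2 ⊙ Q) Q => k w) (oi_eq1 s)).
Qed.

Lemma antipode_lft_surj (p : X2) : exists q : apex Q, lft q = p.
Proof.
(* [z] is the loop at [p.1] followed by the edge [p]; the middle factor of a preimage is an edge of
   [Q] at the same point. *)
pose z : apex (unitc ⊙ one X2) :=
  @conv_elt unitc (one X2) (unit_elt p p.1) p erefl erefl.
have [w ew] := iso_surj (oi_iso2l s) z.
exists (conv_r_elt (conv_l_elt (w : apex (one X2 ⊙ Q ⊙ one X2)))).
rewrite lft_conv_r lft_conv_l.
rewrite -(sq_lft (conv2 (pair_mon X) (pair_com X) tau1 (idq (one X2)))).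
exact: (f_equal (fun z : apex (unitc ⊙ one X2) => lft z) ew).
Qed.

Lemma swap_iso_antipode : oplax_inverse_iso pair_antipode s.
Proof.
have [g K L] := inj_surj_bij antipode_lft_inj antipode_lft_surj.
have e1 p : lft (g p) = @lft _ _ swap_span p by rewrite L.
have e2 p : rgt (g p) = @rgt _ _ swap_span p by rewrite antipode_rgt L.
exists (@Square _ _ _ _ swap_span Q id id g e1 e2); split.
- by apply: lft_bij_iso; [exact: swap_lft_bij | exact: antipode_lft_inj].
- exact/jmono_cell/unit_jmono.
- exact/jmono_cell/unit_jmono.
Qed.

End Unique.

End Pair.

Theorem proposition4p4p3 (X : Type) :
  exists H : oplax_hopf_monoid (X * X),
    hm_bimonoid H = pair_bimonoid X /\
    forall s : oplax_antipode (hm_bimonoid H),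
      oplax_inverse_iso (hm_antipode H) s.
Proof.
exists (OplaxHopfMonoid (pair_antipode X)); split=> // s.
exact: swap_iso_antipode.
Qed.
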